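(* Let $n\ge 1$ and let $\varphi=(\varphi_1,\dots,\varphi_n)$ and $\psi=(\psi_1,\dots,\psi_n)$ be holomorphic self-maps of the unit polydisc $U^n\subset\mathbb{C}^n$. Then the operator $C_\varphi-C_\psi:H^\infty(U^n)\to H^\infty(U^n)$ is compact if and only if $$\lim_{\delta\to 0^+}\ \sup_{z\in E_\delta}\ \max_{1\le j\le n}\beta(\varphi_j(z),\psi_j(z))=0.$$
   Context: $D$ is the open unit disc in $\mathbb{C}$ and $U^n=D^n$ is the open unit polydisc in $\mathbb{C}^n$. $H^\infty(U^n)$ is the Banach space of bounded holomorphic functions $f:U^n\to\mathbb{C}$ with the sup norm. For a holomorphic self-map $\varphi:U^n\to U^n$, the composition operator is $C_\varphi f=f\circ\varphi$ (and similarly $C_\psi f=f\circ\psi$). The pseudo-hyperbolic distance on $D$ is $\beta(z,w)=\left|\frac{z-w}{1-\overline{z}w}\right|$. For $0<\delta<1$ and $1\le j\le n$, $E^j_\delta=\{z\in U^n:\max(|\varphi_j(z)|,|\psi_j(z)|)>1-\delta\}$, and $E_\delta=\bigcup_{j=1}^n E^j_\delta$. Convention: if $E_\delta=\emptyset$ for all sufficiently small $\delta$ (i.e. $\|\varphi_j\|_\infty<1$ and $\|\psi_j\|_\infty<1$ for all $j$), the limit is taken to be $0$. *)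

(* Defs.v *)
From HB Require Import structures.
From mathcomp Require Import all_boot all_order all_algebra.
From mathcomp Require Import all_classical all_reals all_analysis.
From mathcomp Require Import complex.

Set Implicit Arguments.
Unset Strict Implicit.
Unset Printing Implicit Defensive.

Import Order.TTheory GRing.Theory Num.Theory.
Import numFieldNormedType.Exports.

Local Open Scope classical_set_scope.
Local Open Scope ring_scope.
Local Open Scope complex_scope.

Lemma near_eq_differentiable (K : numFieldType) (V W : normedModType K)
    (f g : V -> W) (z : V) :
  (\forall w \near z, f w = g w) -> differentiable f z -> differentiable g z.
Proof.
move=> fg df.
have fgz : f z = g z by exact: nbhs_singleton fg.
have dg : g \o shift z = cst (g z) + 'd f z +o_ 0 id.
  apply/eqaddoP => e e0; have := diff_locally df; move/eqaddoP => /(_ e e0).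
  have fg0 : \forall w \near (0 : V), f (w + z) = g (w + z).
    by move: fg; rewrite (near_shift 0) subr0.
  by apply: filterS2 fg0 => w fgw; rewrite /= !fctE /= -fgw -fgz.
have E : 'd g z = 'd f z :> (V -> W).
  by apply: diff_unique dg; exact: diff_continuous.
by apply/diff_locallyP; rewrite E; split => //; exact: diff_continuous.
Qed.

(* R[i] carries no topology in the libraries; seen as an abstract numeric field
   it gets the usual one and is a normed space over itself.  For maps between
   normed spaces over [Cplx R], [differentiable] is complex (Frechet)
   differentiability, which on an open set is holomorphy. *)
Definition Cplx (R : realType) : numClosedFieldType := R[i].

(* The embedding of R in C. *)
Definition ofR {R : realType} (r : R) : Cplx R := r%:C.

(* The norm [`|z|] lives in [Cplx R]; [modulus z] is the same number in R. *)
Definition modulus {R : realType} (z : Cplx R) : R := Normc.normc z.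

Section Modulus.
Variable R : realType.
Implicit Types (r s : R) (x y : Cplx R).

Lemma ofRM r s : ofR (r * s) = ofR r * ofR s.
Proof. exact: rmorphM. Qed.

Lemma ofRD r s : ofR (r + s) = ofR r + ofR s.
Proof. exact: rmorphD. Qed.

Lemma ler_ofR r s : (ofR r <= ofR s) = (r <= s).
Proof. exact: lecR. Qed.

Lemma ofR_inj : injective (@ofR R).
Proof. exact: complexI. Qed.

Lemma norm_modulus x : `|x| = ofR (modulus x).
Proof. by []. Qed.

Lemma modulus0 : modulus (0 : Cplx R) = 0.
Proof. exact: Normc.normc0. Qed.

Lemma modulusM x y : modulus (x * y) = modulus x * modulus y.
Proof. exact: Normc.normcM. Qed.

Lemma ler_modulusD x y : modulus (x + y) <= modulus x + modulus y.
Proof. exact: le_normcD. Qed.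

Lemma modulus_ge0 x : 0 <= modulus x.
Proof. by case: x => a b; rewrite sqrtr_ge0. Qed.

Lemma modulus_eq0 x : modulus x = 0 -> x = 0.
Proof. exact: Normc.eq0_normc. Qed.

Lemma normC_lt1 x : (`|x| < 1) = (modulus x < 1).
Proof. exact: ltcR. Qed.

End Modulus.

Section Polydisc.
Variables (R : realType) (n : nat).
Local Notation C := (Cplx R).
Local Notation Cn := 'rV[C]_n.

Definition polydisc : set Cn := [set z | forall j, modulus (z ord0 j) < 1].

(* A function on the polydisc is encoded by a function on the whole of C^n;
   the values of a self-map outside the polydisc are irrelevant. *)
Definition holomorphic (W : normedModType C) (f : Cn -> W) :=
  forall z, polydisc z -> differentiable f z.

Record self_map := SelfMap {
  self_map_fun :> Cn -> Cn;
  self_map_polydisc : forall z, polydisc z -> polydisc (self_map_fun z);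
  self_map_holomorphic : holomorphic self_map_fun }.

(* Functions on the polydisc are extended by 0, so that equality in [Hinf] is
   equality on the polydisc. *)
Definition Hinf_pred : {pred Cn -> C} := fun f =>
  `[< [/\ holomorphic f,
          exists M : R, forall z, polydisc z -> modulus (f z) <= M
        & forall z, ~ polydisc z -> f z = 0] >].

Record Hinf := MkHinf { Hinf_fun :> Cn -> C; _ : Hinf_fun \in Hinf_pred }.

HB.instance Definition _ := [isSub for Hinf_fun].
HB.instance Definition _ := [Choice of Hinf by <:].

Lemma HinfP (f : Hinf) :
  [/\ holomorphic f,
      exists M : R, forall z, polydisc z -> modulus (f z) <= M
    & forall z, ~ polydisc z -> f z = 0].
Proof. by have /asboolP := valP f. Qed.

Lemma polydisc0 : polydisc 0.
Proof. by move=> j; rewrite mxE modulus0. Qed.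

Lemma Hinf_submod_closed : submod_closed Hinf_pred.
Proof.
split=> [|a f g /asboolP[hf [M fM] f0] /asboolP[hg [N gN] g0]]; apply/asboolP.
  split=> [z _||//]; first exact: differentiable_cst.
  by exists 0 => z _; rewrite modulus0.
split=> [z Uz||z Uz].
- by apply: differentiableD; [apply: differentiableZ; exact: hf|exact: hg].
- exists (modulus a * M + N) => z Uz; apply: le_trans (ler_modulusD _ _) _.
  rewrite lerD ?gN// [X in modulus X]/(a * f z) modulusM.
  by rewrite ler_wpM2l ?modulus_ge0 ?fM.
- have -> : (a *: f + g) z = a * f z + g z by [].
  by rewrite f0// g0// mulr0 addr0.
Qed.

HB.instance Definition _ :=
  GRing.isSubmodClosed.Build _ _ Hinf_pred Hinf_submod_closed.
HB.instance Definition _ := [SubChoice_isSubLmodule of Hinf by <:].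

Definition supnorm (f : Hinf) : R := sup [set modulus (f z) | z in polydisc].

Lemma has_sup_supnorm (f : Hinf) : has_sup [set modulus (f z) | z in polydisc].
Proof.
have [_ [M fM] _] := HinfP f; split; last by exists M => _ [z Uz <-]; exact: fM.
by exists (modulus (f 0)), 0 => //; exact: polydisc0.
Qed.

Lemma le_supnorm (f : Hinf) z : polydisc z -> modulus (f z) <= supnorm f.
Proof.
by move=> Uz; apply: ub_le_sup; [case: (has_sup_supnorm f)|exists z].
Qed.

Lemma supnorm_le (f : Hinf) (M : R) :
  (forall z, polydisc z -> modulus (f z) <= M) -> supnorm f <= M.
Proof.
move=> fM; apply: ge_sup; first by case: (has_sup_supnorm f).
by move=> _ [z Uz <-]; exact: fM.
Qed.

Lemma supnorm_ge0 (f : Hinf) : 0 <= supnorm f.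
Proof. exact: le_trans (modulus_ge0 _) (le_supnorm f polydisc0). Qed.

(* The norm of a normed space over [Cplx R] takes values in [Cplx R]. *)
Definition Hinf_norm (f : Hinf) : C := ofR (supnorm f).

Lemma Hinf_normD (f g : Hinf) : Hinf_norm (f + g) <= Hinf_norm f + Hinf_norm g.
Proof.
rewrite -ofRD ler_ofR; apply: supnorm_le => z Uz.
by apply: le_trans (ler_modulusD _ _) _; rewrite lerD ?le_supnorm.
Qed.

Lemma Hinf_normZ (a : C) (f : Hinf) : Hinf_norm (a *: f) = `|a| * Hinf_norm f.
Proof.
rewrite norm_modulus -ofRM; congr ofR; apply/eqP; rewrite eq_le.
apply/andP; split.
  apply: supnorm_le => z Uz.
  rewrite [X in modulus X]/(a * f z) modulusM.
  by rewrite ler_wpM2l ?modulus_ge0 ?le_supnorm.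
have [->|a0] := eqVneq a 0; first by rewrite modulus0 mul0r supnorm_ge0.
have na0 : 0 < modulus a.
  by rewrite lt_def modulus_ge0 andbT; apply: contra a0 => /eqP/modulus_eq0 ->.
rewrite mulrC -ler_pdivlMr//; apply: supnorm_le => z Uz.
rewrite ler_pdivlMr// mulrC -modulusM.
exact: (@le_supnorm (a *: f) z Uz).
Qed.

Lemma Hinf_norm_eq0 (f : Hinf) : Hinf_norm f = 0 -> f = 0.
Proof.
move=> /ofR_inj f0; apply/val_inj/funext => z.
have [Uz|nUz] := pselect (polydisc z); last first.
  by case: (HinfP f) => _ _ f_out; exact: f_out.
apply: modulus_eq0; apply/eqP.
by rewrite eq_le modulus_ge0 andbT -f0 le_supnorm.
Qed.

HB.instance Definition _ := @Lmodule_isNormed.Build C Hinf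
  Hinf_norm Hinf_normD Hinf_normZ Hinf_norm_eq0.

End Polydisc.

Arguments polydisc {R n}.

Section Composition.
Variables (R : realType) (n : nat).
Local Notation C := (Cplx R).
Local Notation Cn := 'rV[C]_n.

Lemma ball01E (w : C) : ball (0 : C) 1 w = (modulus w < 1) :> Prop.
Proof. by rewrite -ball_normE /ball_ /= sub0r normrN normC_lt1. Qed.

Lemma open_polydisc : open (@polydisc R n).
Proof.
rewrite openE => z Uz.
apply: (@filter_forall _ _ (fun j (w : Cn) => modulus (w ord0 j) < 1)
  (nbhs z) _) => j.
suff : nbhs z [set w : Cn | modulus (w ord0 j) < 1] by [].
have -> : [set w : Cn | modulus (w ord0 j) < 1] =
    (fun w : Cn => w ord0 j) @^-1` ball (0 : C) 1.
  by apply/seteqP; split=> w /=; rewrite ball01E.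
(* With the ball in the goal, applying [coord_continuous] does not return. *)
have cvj A : nbhs (z ord0 j) A -> nbhs z ((fun w : Cn => w ord0 j) @^-1` A).
  by move=> zA; apply: coord_continuous.
apply: cvj; apply: open_nbhs_nbhs; split; first exact: ball_open.
by rewrite ball01E; exact: Uz.
Qed.

Variable phi : self_map R n.

Definition comp_fun (f : Hinf R n) : Cn -> C :=
  patch (fun=> 0) polydisc (f \o phi).

Lemma comp_fun_Hinf (f : Hinf R n) : comp_fun f \in @Hinf_pred R n.
Proof.
have [hf [M fM] _] := HinfP f.
have compE z : polydisc z -> comp_fun f z = f (phi z).
  by move=> Uz; rewrite /comp_fun patchE ifT// inE.
apply/asboolP; split=> [z Uz||z nUz].
- have d : differentiable (f \o phi) z.
    apply: differentiable_comp; first exact: self_map_holomorphic.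
    exact: hf (self_map_polydisc phi Uz).
  apply: near_eq_differentiable d; near=> w; apply/esym/compE.
  by near: w; apply: open_nbhs_nbhs; split => //; exact: open_polydisc.
- by exists M => z Uz; rewrite compE//; exact: fM (self_map_polydisc phi Uz).
- by rewrite /comp_fun /patch ifN// notin_setE.
Unshelve. all: by end_near. Qed.

Definition comp_op (f : Hinf R n) : Hinf R n := MkHinf (comp_fun_Hinf f).

Lemma comp_op_linear : linear comp_op.
Proof.
move=> a f g; apply/val_inj/funext => z.
have E : (a *: comp_op f + comp_op g) z = a * comp_op f z + comp_op g z by [].
rewrite [LHS]/(comp_fun (a *: f + g) z) [RHS]E /= /comp_fun /patch.
by case: ifP => // _; rewrite mulr0 addr0.
Qed.

HB.instance Definition _ :=
  GRing.isLinear.Build C (Hinf R n) (Hinf R n) _ comp_op comp_op_linear.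

End Composition.

Definition compact_operator (K : numFieldType) (V W : normedModType K)
  (T : {linear V -> W}) :=
  compact (closure (T @` [set x | `|x| <= 1])).

Section PseudoHyperbolic.
Variables (R : realType) (n : nat).
Local Notation C := (Cplx R).

Definition pseudo_hyp (z w : C) : R := modulus ((z - w) / (1 - z^* * w)).

Variables phi psi : self_map R n.

Definition E_coord (delta : R) (j : 'I_n) : set 'rV[C]_n :=
  [set z | polydisc z /\
    1 - delta < Num.max (modulus (phi z ord0 j)) (modulus (psi z ord0 j))].

(* When [E_set delta] is empty, so is the set of the values of a function on it,
   and [sup set0 = 0] in the library. *)
Definition E_set (delta : R) : set 'rV[C]_n :=
  \bigcup_(j in [set: 'I_n]) E_coord delta j.

End PseudoHyperbolic.

(* Main.v *)
Require Import Defs.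
From mathcomp Require Import all_boot all_order all_algebra.
From mathcomp Require Import all_classical all_reals all_analysis.
From mathcomp Require Import complex ring lra.
Import Order.TTheory GRing.Theory Num.Theory.
Import numFieldNormedType.Exports.
Local Open Scope classical_set_scope.
Local Open Scope ring_scope.

(** Write T = C_phi - C_psi.

If the limit is 0, let f range over the unit ball of H^oo and choose, along an
ultrafilter on the ball, the pointwise limit of f.  Cauchy estimates make the
quadratic Taylor remainder of f uniform over the ball ([polydisc_taylor]), so
that the limit is again holomorphic ([montel]), and they make f equicontinuous
on smaller polydiscs, so that the convergence is uniform there
([ultra_lim_uniform]).  Hence T f converges uniformly off E_delta.  On E_delta
the two points phi(z) and psi(z) are pseudo-hyperbolically close, and a bounded
holomorphic function varies little between such points: if
|b_j - a_j| <= e (1 - |a_j|) for all j, the complex line through a and b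
contains a disc of radius 1/e around a inside the polydisc, and the Cauchy
estimate on this disc gives |f(b) - f(a)| <= 8 M e ([polydisc_lipschitz]).  So
T maps the unit ball onto a compact set.

Conversely, if the limit is not 0, there are e > 0 and points z_m such that
some coordinate i of phi(z_m) or psi(z_m) has modulus so close to 1 that its
m-th power is at least 1/2, while in some coordinate j, which may differ from
i, the two images are at pseudo-hyperbolic distance at least e.  The function
w_i^m B(w_j), where B is the Blaschke factor vanishing at the j-th coordinate
of the other image, is in the unit ball, and T maps it to a function of norm
at least e/2 ([peak_difference]).  These functions tend to 0 pointwise, so
their images under T have no limit point in norm.

The Cauchy estimates are obtained without integration.  Riemann sums over
2^m equally spaced points are additive under bisection, so Goursat's bisection
argument applies to them directly and shows that, for a function that is just
pointwise complex differentiable, the sums around a rectangle tend to 0 with m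
([goursat]).  In polar coordinates the two radial sides cancel, so circular
means hardly depend on the radius, whence the maximum principle at the centre
of a disc ([center_max_principle]) for functions that are merely continuous at
this centre.  So it applies to difference quotients, and bounds derivatives
([has_deriv_bound]). *)

Set Implicit Arguments.
Unset Strict Implicit.
Unset Printing Implicit Defensive.

(** * Goursat's lemma for dyadic Riemann sums *)

Section Goursat.
Variable R : realType.
Implicit Types (f g : R -> R) (P Q : R -> R -> R) (a w c h e x y : R).

(** The left Riemann sum of f over [a, a + w] with 2^m equal steps.  Recursion by
bisection makes additivity over the two halves hold by computation. *)
Fixpoint dyadic_sum m f (a w : R) : R :=
  if m is m'.+1 then
    dyadic_sum m' f a (w / 2) + dyadic_sum m' f (a + w / 2) (w / 2)
  else f a * w.

Lemma dyadic_sum_le m f a w M : 0 <= w ->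
  (forall x, a <= x <= a + w -> f x <= M) -> dyadic_sum m f a w <= M * w.
Proof.
elim: m a w => [|m IH] a w w0 fM /=.
  by rewrite ler_wpM2r// fM// lexx lerDl.
have -> : M * w = M * (w / 2) + M * (w / 2) by field.
by rewrite lerD// IH// => [|x|| x] *; try apply: fM; lra.
Qed.

Lemma dyadic_sum_ge m f a w M : 0 <= w ->
  (forall x, a <= x <= a + w -> M <= f x) -> M * w <= dyadic_sum m f a w.
Proof.
elim: m a w => [|m IH] a w w0 fM /=.
  by rewrite ler_wpM2r// fM// lexx lerDl.
have -> : M * w = M * (w / 2) + M * (w / 2) by field.
by rewrite lerD// IH// => [|x|| x] *; try apply: fM; lra.
Qed.

Lemma dyadic_sumB m f g a w :
  dyadic_sum m f a w - dyadic_sum m g a w = dyadic_sum m (fun x => f x - g x) a w.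
Proof.
by elim: m a w => [|m IH] a w /=; [rewrite mulrBl|rewrite -!IH addrACA opprD].
Qed.

(** For f and g the restrictions of a form to two opposite sides of a rectangle, K is
the contribution of the linear part of the form. *)
Lemma dyadic_sumB_near m f g a w K e : 0 <= w ->
  (forall x, a <= x <= a + w -> `|f x - g x - K| <= e) ->
  `|dyadic_sum m f a w - dyadic_sum m g a w - K * w| <= e * w.
Proof.
move=> w0 fgK; rewrite dyadic_sumB ler_norml; apply/andP; split.
  suff : (K - e) * w <= dyadic_sum m (fun x => f x - g x) a w by lra.
  by apply: dyadic_sum_ge => // x /fgK; rewrite ler_norml => /andP[]; lra.
suff : dyadic_sum m (fun x => f x - g x) a w <= (K + e) * w by lra.
by apply: dyadic_sum_le => // x /fgK; rewrite ler_norml => /andP[]; lra.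
Qed.

(** The sum for P dx + Q dy around the rectangle [a, a + w] x [c, c + h],
counterclockwise. *)
Definition boundary_sum m P Q (a w c h : R) : R :=
  dyadic_sum m (P^~ c) a w - dyadic_sum m (P^~ (c + h)) a w
  + (dyadic_sum m (Q (a + w)) c h - dyadic_sum m (Q a) c h).

(** The inner edges of the four quarters cancel exactly, because adjacent quarters
use the same sample points on their common edge. *)
Lemma boundary_sumS m P Q a w c h :
  boundary_sum m.+1 P Q a w c h =
    boundary_sum m P Q a (w / 2) c (h / 2)
  + boundary_sum m P Q (a + w / 2) (w / 2) c (h / 2)
  + boundary_sum m P Q a (w / 2) (c + h / 2) (h / 2)
  + boundary_sum m P Q (a + w / 2) (w / 2) (c + h / 2) (h / 2).
Proof.
have half x y : x + y / 2 + y / 2 = x + y :> R by field.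
by rewrite /boundary_sum /= !half; ring.
Qed.

(** P and Q are differentiable at (x0, y0), and the common slope B expresses
dP/dy = dQ/dx there. *)
Definition closed_form_at P Q (x0 y0 : R) := exists A B D : R,
  forall e, 0 < e -> exists2 d, 0 < d & forall x y : R,
    `|x - x0| <= d -> `|y - y0| <= d ->
    `|P x y - P x0 y0 - (A * (x - x0) + B * (y - y0))|
       <= e * (`|x - x0| + `|y - y0|) /\
    `|Q x y - Q x0 y0 - (B * (x - x0) + D * (y - y0))|
       <= e * (`|x - x0| + `|y - y0|).

(** The linear parts of P and Q contribute - B h w and B w h, which cancel; what is
left is controlled by the remainders, for all m at once. *)
Lemma boundary_sum_small P Q x0 y0 e : closed_form_at P Q x0 y0 -> 0 < e ->
  exists2 d, 0 < d & forall m a w c h, 0 <= w <= d -> 0 <= h <= d ->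
    a <= x0 <= a + w -> c <= y0 <= c + h ->
    `|boundary_sum m P Q a w c h| <= e * (w + h) ^+ 2.
Proof.
move=> [A [B [D PQ]]] e0.
have [|d d0 {}PQ] := PQ (e / 2); first by lra.
exists d => // m a w c h /andP[w0 wd] /andP[h0 hd] /andP[ax xw] /andP[cy yh].
have bnd x y : a <= x <= a + w -> c <= y <= c + h ->
    `|P x y - P x0 y0 - (A * (x - x0) + B * (y - y0))| <= e / 2 * (w + h) /\
    `|Q x y - Q x0 y0 - (B * (x - x0) + D * (y - y0))| <= e / 2 * (w + h).
  move=> /andP[ax' xw'] /andP[cy' yh'].
  have xx : `|x - x0| <= w by rewrite ler_norml; lra.
  have yy : `|y - y0| <= h by rewrite ler_norml; lra.
  have [|| p q] := PQ x y; [exact: le_trans wd|exact: le_trans hd|].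
  have le : e / 2 * (`|x - x0| + `|y - y0|) <= e / 2 * (w + h).
    by rewrite ler_wpM2l ?lerD//; lra.
  by split; [exact: le_trans p le|exact: le_trans q le].
have p : `|dyadic_sum m (P^~ c) a w - dyadic_sum m (P^~ (c + h)) a w - - (B * h) * w|
    <= e * (w + h) * w.
  apply: dyadic_sumB_near => // x xa.
  have [|+ _] := bnd x c xa; first by lra.
  have [|+ _] := bnd x (c + h) xa; first by lra.
  by rewrite !ler_norml => /andP[? ?] /andP[? ?]; apply/andP; split; lra.
have q : `|dyadic_sum m (Q (a + w)) c h - dyadic_sum m (Q a) c h - (B * w) * h|
    <= e * (w + h) * h.
  apply: dyadic_sumB_near => // y yc.
  have [|_ +] := bnd a y _ yc; [by lra|].
  have [|_ +] := bnd (a + w) y _ yc; [by lra|].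
  by rewrite !ler_norml => /andP[? ?] /andP[? ?]; apply/andP; split; lra.
move: p q; rewrite /boundary_sum.
set u := dyadic_sum _ _ _ _ - _; set v := dyadic_sum _ _ _ _ - _ => p q.
have -> : u + v = (u - - (B * h) * w) + (v - (B * w) * h) by ring.
apply: le_trans (ler_normD _ _) _.
have -> : e * (w + h) ^+ 2 = e * (w + h) * w + e * (w + h) * h by ring.
exact: lerD.
Qed.

(** The bound is proportional to (w + h)^2 rather than to the area so that it is
divided by exactly 4 at each bisection, whatever the shape of the rectangle. *)
Definition bad_box P Q e (k : nat) (W H : R) (p : R * R) :=
  forall m0, exists2 m, (m0 <= m)%N &
    e * (W / 2 ^+ k + H / 2 ^+ k) ^+ 2 <
    `|boundary_sum m P Q p.1 (W / 2 ^+ k) p.2 (H / 2 ^+ k)|.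

Lemma bad_box_half P Q e k W H p : bad_box P Q e k W H p ->
  exists2 q, bad_box P Q e k.+1 W H q &
    (q.1 = p.1 \/ q.1 = p.1 + W / 2 ^+ k.+1) /\
    (q.2 = p.2 \/ q.2 = p.2 + H / 2 ^+ k.+1).
Proof.
move=> bad; apply: contrapT => nex.
pose w := W / 2 ^+ k.+1; pose h := H / 2 ^+ k.+1.
have good q : (q.1 = p.1 \/ q.1 = p.1 + w) /\ (q.2 = p.2 \/ q.2 = p.2 + h) ->
    exists m0, forall m, (m0 <= m)%N ->
      `|boundary_sum m P Q q.1 w q.2 h| <= e * (w + h) ^+ 2.
  move=> qp; apply: contrapT => nq; apply: nex; exists q => // m0.
  apply: contrapT => nm; apply: nq; exists m0 => m m0m.
  by rewrite leNgt; apply/negP => lt; apply: nm; exists m.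
have [m1 g1] := good (p.1, p.2) (conj (or_introl erefl) (or_introl erefl)).
have [m2 g2] := good (p.1 + w, p.2) (conj (or_intror erefl) (or_introl erefl)).
have [m3 g3] := good (p.1, p.2 + h) (conj (or_introl erefl) (or_intror erefl)).
have [m4 g4] := good (p.1 + w, p.2 + h) (conj (or_intror erefl) (or_intror erefl)).
have [[//|m]] := bad (m1 + m2 + m3 + m4).+1; rewrite ltnS => mm.
have -> : W / 2 ^+ k = w * 2 by rewrite /w exprS invfM; field; rewrite expf_neq0.
have -> : H / 2 ^+ k = h * 2 by rewrite /h exprS invfM; field; rewrite expf_neq0.
rewrite ltNge => /negP; apply; rewrite boundary_sumS !mulfK ?pnatr_eq0//.
have -> : e * (w * 2 + h * 2) ^+ 2 = e * (w + h) ^+ 2 + e * (w + h) ^+ 2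
    + e * (w + h) ^+ 2 + e * (w + h) ^+ 2 by ring.
have l1 : (m1 <= m)%N by apply: leq_trans mm; rewrite -!addnA leq_addr.
have l2 : (m2 <= m)%N by apply: leq_trans mm; rewrite -!addnA addnCA leq_addr.
have l3 : (m3 <= m)%N by apply: leq_trans mm; rewrite addnAC leq_addl.
have l4 : (m4 <= m)%N by apply: leq_trans mm; rewrite leq_addl.
apply: le_trans (ler_normD _ _) _; apply: lerD; last exact: g4.
apply: le_trans (ler_normD _ _) _; apply: lerD; last exact: g3.
by apply: le_trans (ler_normD _ _) _; apply: lerD; [exact: g1|exact: g2].
Qed.

Lemma nested_intervals (u w : nat -> R) :
  (forall k, u k <= u k.+1) -> (forall k, u k.+1 + w k.+1 <= u k + w k) ->
  (forall k, 0 <= w k) -> exists x, forall k, u k <= x <= u k + w k.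
Proof.
move=> u_up v_down w0.
have uS i j : u i <= u (i + j)%N.
  by elim: j => [|j IH]; rewrite ?addn0// addnS (le_trans IH).
have vS i j : u (i + j)%N + w (i + j)%N <= u i + w i.
  by elim: j => [|j IH]; rewrite ?addn0// addnS (le_trans _ IH).
have uv i j : u i <= u j + w j.
  apply: le_trans (uS i j) _; rewrite addnC.
  by apply: le_trans (vS j i); rewrite lerDl.
exists (sup (range u)) => k; apply/andP; split.
  by apply: ub_le_sup; [exists (u 0%N + w 0%N) => _ [i _ <-]|exists k].
by apply: ge_sup; [exists (u 0%N), 0%N|move=> _ [i _ <-]].
Qed.

(** Bad boxes nest down to a point, and near this point differentiability
contradicts badness. *)
Lemma goursat P Q a w c h e : 0 <= w -> 0 <= h -> 0 < e ->
  (forall x y, a <= x <= a + w -> c <= y <= c + h -> closed_form_at P Q x y) ->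
  exists m0, forall m, (m0 <= m)%N ->
    `|boundary_sum m P Q a w c h| <= e * (w + h) ^+ 2.
Proof.
move=> w0 h0 e0 PQ; apply: contrapT => nm.
have bad0 : bad_box P Q e 0 w h (a, c).
  move=> m0; apply: contrapT => nb; apply: nm; exists m0 => m m0m.
  by rewrite leNgt; apply/negP => lt; apply: nb; exists m; rewrite //= !divr1.
pose T := {kp : nat * (R * R) | bad_box P Q e kp.1 w h kp.2}.
pose next (s t : T) := (sval t).1 = (sval s).1.+1 /\
  ((sval t).2.1 = (sval s).2.1 \/ (sval t).2.1 = (sval s).2.1 + w / 2 ^+ (sval s).1.+1) /\
  ((sval t).2.2 = (sval s).2.2 \/ (sval t).2.2 = (sval s).2.2 + h / 2 ^+ (sval s).1.+1).
have [|f [f0 fS]] := @dependent_choice T next _ (exist _ (0%N, (a, c)) bad0).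
  move=> [[k p] /= bk]; apply: cid; have [q bq qp] := @bad_box_half P Q e k w h p bk.
  by exists (exist _ (k.+1, q) bq).
have fk k : (sval (f k)).1 = k.
  by elim: k => [|k IH]; [rewrite f0|have [-> _] := fS k; rewrite IH].
have bad k : bad_box P Q e k w h (sval (f k)).2.
  by have := svalP (f k); rewrite fk.
have step k : let p := (sval (f k)).2 in let q := (sval (f k.+1)).2 in
    (q.1 = p.1 \/ q.1 = p.1 + w / 2 ^+ k.+1) /\ (q.2 = p.2 \/ q.2 = p.2 + h / 2 ^+ k.+1).
  by have [_] := fS k; rewrite fk.
pose p k := (sval (f k)).2.
have halfS (t : R) k : t / 2 ^+ k = t / 2 ^+ k.+1 + t / 2 ^+ k.+1.
  by rewrite exprS invfM; field; rewrite expf_neq0.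
have div0 (t : R) k : 0 <= t -> 0 <= t / 2 ^+ k.
  by move=> t0; rewrite divr_ge0 ?exprn_ge0.
have [x xP] : exists x, forall k, (p k).1 <= x <= (p k).1 + w / 2 ^+ k.
  apply: nested_intervals => k; last exact: div0.
    by have [[->|->] _] := step k; rewrite ?lerDl ?div0.
  rewrite (halfS w k); have := div0 w k.+1 w0.
  by have [[->|->] _] := step k; rewrite /p; lra.
have [y yP] : exists y, forall k, (p k).2 <= y <= (p k).2 + h / 2 ^+ k.
  apply: nested_intervals => k; last exact: div0.
    by have [_ [->|->]] := step k; rewrite ?lerDl ?div0.
  rewrite (halfS h k); have := div0 h k.+1 h0.
  by have [_ [->|->]] := step k; rewrite /p; lra.
have xa : a <= x <= a + w by have := xP 0%N; rewrite /p f0 /= expr0 divr1.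
have yc : c <= y <= c + h by have := yP 0%N; rewrite /p f0 /= expr0 divr1.
have [d d0 small] := boundary_sum_small (PQ _ _ xa yc) e0.
pose k := Num.bound ((w + h) / d).
have kd : w + h <= d * 2 ^+ k.
  rewrite mulrC -ler_pdivrMr//; apply: le_trans (ltW (archi_boundP _)) _.
    by rewrite divr_ge0//; lra.
  by rewrite -natrX ler_nat ltnW// ltn_expl.
have [m _] := bad k 0%N.
rewrite ltNge => /negP; apply; apply: small; rewrite ?div0//=; last 2 first.
- exact: xP.
- exact: yP.
  by rewrite ler_pdivrMr ?exprn_gt0//; lra.
by rewrite ler_pdivrMr ?exprn_gt0//; lra.
Qed.
End Goursat.

(** * Complex differentiability and the maximum principle at a centre *)

Section ComplexBasics.
Variable R : realType.
Local Notation C := (Cplx R).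
Implicit Types (z w : C) (x y : R).

Definition re z : R := complex.Re z.
Definition im z : R := complex.Im z.
Definition cplx x y : C := Complex x y.

Lemma reD z w : re (z + w) = re z + re w. Proof. by case: z w => [a b] [c d]. Qed.
Lemma imD z w : im (z + w) = im z + im w. Proof. by case: z w => [a b] [c d]. Qed.
Lemma reN z : re (- z) = - re z. Proof. by case: z. Qed.
Lemma imN z : im (- z) = - im z. Proof. by case: z. Qed.
Lemma reM z w : re (z * w) = re z * re w - im z * im w.
Proof. by case: z w => [a b] [c d]. Qed.
Lemma imM z w : im (z * w) = re z * im w + im z * re w.
Proof. by case: z w => [a b] [c d]. Qed.

Lemma re_ofRM x z : re (ofR x * z) = x * re z.
Proof. by rewrite reM [im _]/= mul0r subr0. Qed.

Lemma modulusE z : modulus z = Num.sqrt (re z ^+ 2 + im z ^+ 2).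
Proof. by case: z. Qed.

Lemma modulus_ofR x : modulus (ofR x) = `|x|.
Proof. by rewrite modulusE /re /im /= expr0n addr0 sqrtr_sqr. Qed.

Lemma modulusN z : modulus (- z) = modulus z.
Proof. by rewrite !modulusE reN imN !sqrrN. Qed.

Lemma modulusC z w : modulus (z - w) = modulus (w - z).
Proof. by rewrite -modulusN opprB. Qed.

Lemma modulusV z : modulus z^-1 = (modulus z)^-1.
Proof.
have := @normfV C z; rewrite !norm_modulus => h; apply: ofR_inj; rewrite h.
by rewrite /ofR; exact: (esym (fmorphV (@real_complex R) (modulus z))).
Qed.

Lemma modulus1 : modulus (1 : C) = 1.
Proof. by have := modulus_ofR 1; rewrite normr1. Qed.

Lemma re_le z : re z <= modulus z.
Proof.
apply: le_trans (ler_norm _) _; rewrite modulusE -sqrtr_sqr ler_wsqrtr//.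
by rewrite lerDl sqr_ge0.
Qed.

Lemma norm_re_le z : `|re z| <= modulus z.
Proof.
by rewrite modulusE -sqrtr_sqr ler_wsqrtr// lerDl sqr_ge0.
Qed.

Lemma norm_im_le z : `|im z| <= modulus z.
Proof.
by rewrite modulusE -sqrtr_sqr ler_wsqrtr// lerDr sqr_ge0.
Qed.

Lemma modulus_le z : modulus z <= `|re z| + `|im z|.
Proof.
rewrite modulusE -(ger0_norm (addr_ge0 (normr_ge0 (re z)) (normr_ge0 (im z)))).
rewrite -sqrtr_sqr ler_wsqrtr// sqrrD !real_normK ?num_real//.
by rewrite lerD2r lerDl mulrn_wge0// mulr_ge0.
Qed.

Lemma modulus_gt0 z : z != 0 -> 0 < modulus z.
Proof.
move=> z0; rewrite lt_def modulus_ge0 andbT.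
by apply: contra z0 => /eqP/modulus_eq0 ->.
Qed.

Lemma ler_modulusB z w : modulus (z - w) <= modulus z + modulus w.
Proof. by rewrite -(modulusN w) ler_modulusD. Qed.

(** Multiplying by c turns a bound on a modulus into a bound on a real part, the
form in which the maximum principle is available. *)
Lemma phase z : exists2 c : C, modulus c = 1 & c * z = ofR (modulus z).
Proof.
have [->|z0] := eqVneq z 0.
  by exists 1; rewrite ?modulus1// mulr0 modulus0.
exists (ofR (modulus z) / z).
  rewrite modulusM modulusV modulus_ofR ger0_norm ?modulus_ge0//.
  by rewrite divff// gt_eqF// modulus_gt0.
by rewrite divfK.
Qed.

End ComplexBasics.
Section Expansion.
Variable K : numFieldType.
Implicit Types (f : K -> K) (z w l : K).

Lemma differentiable_expansion f z e : differentiable f z -> 0 < e ->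
  \forall w \near 0, `|f (z + w) - f z - 'd f z 1 * w| <= e * `|w|.
Proof.
move=> df e0; have := diff_locally df => /eqaddoP/(_ e e0).
apply: filterS => w; rewrite !fctE /=; congr (`|_| <= _).
rewrite [w + z]addrC opprD addrA; congr (_ - _).
by rewrite -[w in LHS]mulr1 [LHS]linearZ /= mulrC.
Qed.

Lemma expansion_differentiable f z l :
  (forall e, 0 < e -> \forall w \near 0, `|f (z + w) - f z - l * w| <= e * `|w|) ->
  differentiable f z /\ 'd f z 1 = l.
Proof.
move=> df.
have ml : differentiable (l *: (id : K -> K)) z.
  by apply: differentiableZ; exact: ex_diff.
have dl : continuous ('d (l *: (id : K -> K)) z) by exact: diff_continuous.
have dlE w : 'd (l *: (id : K -> K)) z w = l * w.
  rewrite diffZ; last exact: ex_diff.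
  by rewrite /= (@diff_lin K K K idfun)//; move=> ?; exact: cvg_id.
have ef : f \o shift z = cst (f z) + 'd (l *: (id : K -> K)) z +o_ (0 : K) id.
  apply/eqaddoP => e /df; apply: filterS => w.
  by rewrite !fctE /= dlE [w + z]addrC opprD addrA.
have E := diff_unique dl ef.
split; first by apply/diff_locallyP; rewrite E; split.
by rewrite E dlE mulr1.
Qed.

End Expansion.

Section Deriv.
Variable R : realType.
Local Notation C := (Cplx R).
Implicit Types (f g : C -> C) (z w l : C).

(** Complex differentiability with all moduli and bounds in R, whose order is total,
unlike that of the norm's codomain C. *)
Definition has_deriv f z l := forall e : R, 0 < e -> exists2 d : R, 0 < d &
  forall w, modulus w <= d ->
    modulus (f (z + w) - f z - l * w) <= e * modulus w.

Lemma posC (e : C) : 0 < e -> exists2 r : R, 0 < r & e = ofR r.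
Proof.
case: e => a b; rewrite ltcE /= => /andP[/eqP b0 a0].
by exists a => //; congr Complex.
Qed.

Lemma near0_modulus (P : C -> Prop) :
  (\forall w \near (0 : C), P w) <->
  exists2 d : R, 0 < d & forall w, modulus w <= d -> P w.
Proof.
split=> [/nbhs_ballP[e /= /posC[d d0 ->] dP]|[d d0 dP]].
  exists (d / 2); first by lra.
  move=> w wd; apply: dP; rewrite -ball_normE /ball_ /= sub0r normrN.
  rewrite norm_modulus ltcR; lra.
apply/nbhs_ballP; exists (ofR d); first by rewrite /= ltcR.
move=> w; rewrite -ball_normE /ball_ /= sub0r normrN norm_modulus ltcR => /ltW.
exact: dP.
Qed.

Lemma differentiable_has_deriv f z : differentiable f z ->
  has_deriv f z ('d f z 1).
Proof.
move=> df e e0; apply/near0_modulus.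
have := differentiable_expansion df; move=> /(_ (ofR e)); rewrite ltcR => /(_ e0).
by apply: filterS => w; rewrite !norm_modulus -ofRM ler_ofR.
Qed.

Lemma has_deriv_differentiable f z l : has_deriv f z l -> differentiable f z.
Proof.
move=> df; apply: (proj1 (expansion_differentiable (l := l) _)) => e /posC[r r0 ->].
have /near0_modulus := df _ r0.
by apply: filterS => w; rewrite !norm_modulus -ofRM ler_ofR.
Qed.

End Deriv.

Section RealExpansion.
Variable R : realType.
Implicit Types (f : R -> R) (x l e : R).

Lemma near0_norm (P : R -> Prop) : (\forall w \near (0 : R), P w) <->
  exists2 d : R, 0 < d & forall w, `|w| <= d -> P w.
Proof.
split=> [/nbhs_ballP[e /= e0 dP]|[d d0 dP]].
  exists (e / 2); first by lra.
  by move=> w wd; apply: dP; rewrite -ball_normE /ball_ /= sub0r normrN; lra.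
apply/nbhs_ballP; exists d => // w; rewrite -ball_normE /ball_ /= sub0r normrN.
by move=> /ltW; exact: dP.
Qed.

Lemma is_derive_expansion f x l : is_derive x 1 f l <->
  forall e, 0 < e -> exists2 d, 0 < d &
    forall h, `|h| <= d -> `|f (x + h) - f x - l * h| <= e * `|h|.
Proof.
split=> [[/derivable1_diffP df <-] e e0|H].
  apply/near0_norm; rewrite deriveE//; exact: differentiable_expansion.
have [df dE] : differentiable f x /\ 'd f x 1 = l.
  by apply: expansion_differentiable => e e0; apply/near0_norm; exact: H.
by split; [exact/derivable1_diffP|rewrite deriveE].
Qed.

End RealExpansion.

Section MaximumPrinciple.
Variable R : realType.
Local Notation C := (Cplx R).

Definition cexp (z : C) : C :=
  cplx (expR (re z) * cos (im z)) (expR (re z) * sin (im z)).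

Lemma cexpD z w : cexp (z + w) = cexp z * cexp w.
Proof.
by rewrite /cexp reD imD expRD cosD sinD; congr Complex; rewrite /=; ring.
Qed.

Lemma cexp0 : cexp 0 = 1.
Proof. by rewrite /cexp expR0 cos0 sin0 !mul1r. Qed.

Lemma modulus_cexp z : modulus (cexp z) = expR (re z).
Proof.
rewrite modulusE /= !exprMn -mulrDr cos2Dsin2 mulr1 sqrtr_sqr.
by rewrite ger0_norm// expR_ge0.
Qed.

(** Writing X, Y and S for the remainders of expR at 0, of cos and of sin, the real
part of the remainder of cexp is X + (1 + x + X) Y and the imaginary part is
S + (x + X)(y + S). *)
Lemma has_deriv_cexp0 : has_deriv cexp 0 1.
Proof.
move=> e e0.
have /is_derive_expansion E1 : is_derive (0 : R) 1 expR (1 : R).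
  by rewrite -[X in is_derive _ _ _ X]expR0; exact: is_derive_expR.
have /is_derive_expansion E2 : is_derive (0 : R) 1 cos (0 : R).
  by rewrite -[X in is_derive _ _ _ X]oppr0 -[X in is_derive _ _ _ (- X)]sin0;
    exact: is_derive_cos.
have /is_derive_expansion E3 : is_derive (0 : R) 1 sin (1 : R).
  by rewrite -[X in is_derive _ _ _ X]cos0; exact: is_derive_sin.
(* The two parts of the remainder add up to at most 9 e' |w|. *)
pose e' := Num.min (e / 9) 1.
have e'0 : 0 < e' by rewrite lt_min ltr01 andbT; lra.
have e'1 : e' <= 1 by rewrite ge_min lexx orbT.
have e'e : e' <= e / 9 by rewrite ge_min lexx.
clearbody e'.
have [d1 d10 {}E1] := E1 _ e'0.
have [d2 d20 {}E2] := E2 _ e'0.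
have [d3 d30 {}E3] := E3 _ e'0.
exists (Num.min d1 (Num.min d2 (Num.min d3 e'))).
  by rewrite !lt_min d10 d20 d30 e'0.
move=> w; rewrite !le_min => /and4P[w1 w2 w3 we].
have xw := norm_re_le w; have yw := norm_im_le w.
have {E1} := E1 _ (le_trans xw w1).
have {E2} := E2 _ (le_trans yw w2).
have {E3} := E3 _ (le_trans yw w3).
rewrite !add0r mul0r !mul1r expR0 cos0 sin0 !subr0.
set x := re w in xw *; set y := im w in yw *.
set X := expR x - 1 - x; set Y := cos y - 1; set S := sin y - y => S_le Y_le X_le.
have y0 := normr_ge0 y; have x0 := normr_ge0 x.
have ex_le : e' * `|x| <= `|x| by rewrite ler_piMl.
have ey_le : e' * `|y| <= `|y| by rewrite ler_piMl.
have rE : re (cexp w - cexp 0 - w) = X + (1 + x + X) * Y.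
  rewrite cexp0 !(reD, reN) -/x; have -> : re (cexp w) = expR x * cos y by [].
  by have -> : re (1 : C) = 1 by []; rewrite /X /Y; ring.
have iE : im (cexp w - cexp 0 - w) = S + (x + X) * (y + S).
  rewrite cexp0 !(imD, imN) -/y; have -> : im (cexp w) = expR x * sin y by [].
  by have -> : im (1 : C) = 0 by []; rewrite /X /S; ring.
apply: le_trans (modulus_le _) _; rewrite rE iE.
have r_le : `|X + (1 + x + X) * Y| <= e' * `|x| + 3 * (e' * `|y|).
  apply: le_trans (ler_normD _ _) _; rewrite lerD// normrM ler_pM//.
  apply: le_trans (ler_normD _ _) _.
  by have := ler_normD 1 x; rewrite normr1; lra.
have i_le : `|S + (x + X) * (y + S)| <= e' * `|y| + 4 * (e' * `|x|).
  apply: le_trans (ler_normD _ _) _; rewrite lerD// normrM.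
  apply: (@le_trans _ _ ((2 * `|x|) * (2 * `|y|))).
    by rewrite ler_pM// (le_trans (ler_normD _ _))//; lra.
  have : `|x| * `|y| <= `|x| * e' by rewrite ler_wpM2l//; lra.
  by lra.
have : e' * `|x| <= e' * modulus w by rewrite ler_pM2l.
have : e' * `|y| <= e' * modulus w by rewrite ler_pM2l.
have : e' * modulus w <= e / 9 * modulus w by rewrite ler_wpM2r ?modulus_ge0.
lra.
Qed.

Lemma differentiable_cexp z : differentiable cexp z.
Proof.
apply: (@has_deriv_differentiable _ _ _ (cexp z)) => e e0.
have c0 : 0 < modulus (cexp z) by rewrite modulus_cexp expR_gt0.
have [|d d0 H] := has_deriv_cexp0 (e := e / modulus (cexp z)).
  by rewrite divr_gt0.
exists d => // w /H {}H; move: H; rewrite add0r cexp0 mul1r cexpD => H.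
have -> : cexp z * cexp w - cexp z - cexp z * w = cexp z * (cexp w - 1 - w) by ring.
by rewrite modulusM mulrC -ler_pdivlMr// [leRHS]mulrAC.
Qed.

(** The form Im (g dz) is closed by the Cauchy-Riemann equations. *)
Lemma closed_form_has_deriv (g : C -> C) (x y : R) l : has_deriv g (cplx x y) l ->
  closed_form_at (fun x y => im (g (cplx x y))) (fun x y => re (g (cplx x y))) x y.
Proof.
move=> gl; exists (im l), (re l), (- im l) => e e0.
have [d d0 H] := gl e e0; exists (d / 2) => [|x' y' xx yy]; first by lra.
have ww : modulus (cplx (x' - x) (y' - y)) <= `|x' - x| + `|y' - y|.
  exact: modulus_le.
have := H (cplx (x' - x) (y' - y)) (le_trans ww _).
have -> : cplx x y + cplx (x' - x) (y' - y) = cplx x' y'.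
  by congr Complex; rewrite addrC subrK.
move=> /(_ _)/le_trans H'.
have {H'} : modulus (g (cplx x' y') - g (cplx x y) - l * cplx (x' - x) (y' - y)) <=
    e * (`|x' - x| + `|y' - y|).
  by apply: H'; [lra|rewrite ler_pM2l].
set D := g _ - _ - _ => H'.
have imE : im D = im (g (cplx x' y')) - im (g (cplx x y)) -
    (im l * (x' - x) + re l * (y' - y)).
  rewrite /D !(imD, imN, imM).
  set a := im (g _); set b := im (g _); rewrite /=; ring.
have reE : re D = re (g (cplx x' y')) - re (g (cplx x y)) -
    (re l * (x' - x) + - im l * (y' - y)).
  rewrite /D !(reD, reN, reM).
  set a := re (g _); set b := re (g _); rewrite /=; ring.
by rewrite -imE -reE; split; apply: le_trans H'; [exact: norm_im_le|exact: norm_re_le].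
Qed.

(** In the coordinates z = r exp(x + i y), with -T <= x <= 0 and 0 <= y <= 2 pi, the
function F is 2 pi-periodic in y, so the sums over the sides y = 0 and
y = 2 pi cancel.  By Goursat's lemma the mean of Re F over |z| = r, which is at
most M, is then almost the mean over the circle of radius r exp(- T), which is
close to Re F(0) by continuity. *)
Lemma center_max_principle (F : C -> C) (r M : R) : 0 < r ->
  (forall z : C, z != 0 -> modulus z <= r -> differentiable F z) ->
  (forall e : R, 0 < e -> exists2 d : R, 0 < d &
     forall z, modulus z <= d -> modulus (F z - F 0) <= e) ->
  (forall z, modulus z = r -> re (F z) <= M) -> re (F 0) <= M.
Proof.
move=> r0 dF cF FM; apply/ler_addgt0Pr => e e0.
have [|d d0 {}cF] := cF (e / 2); first by lra.
(* expR T >= 1 + T makes the inner radius r expR (- T) at most d. *)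
pose T := r / d; have T0 : 0 <= T by rewrite divr_ge0// ltW.
have Td : r * expR (- T) <= d.
  rewrite expRN ler_pdivrMr ?expR_gt0// mulrC -ler_pdivrMr// -/T.
  by apply: le_trans (expR_ge1Dx T); lra.
pose g z := F (ofR r * cexp z).
have modg z : modulus (ofR r * cexp z) = r * expR (re z).
  by rewrite modulusM modulus_ofR modulus_cexp gtr0_norm.
have dg z : re z <= 0 -> differentiable g z.
  move=> z0; apply: (@differentiable_comp _ _ _ _ (fun z => ofR r * cexp z) F).
    exact: (@differentiableZ _ _ _ cexp (ofR r) z (differentiable_cexp z)).
  apply: dF.
    apply/eqP => /(congr1 modulus); rewrite modg modulus0.
    by apply/eqP; rewrite mulf_neq0// gt_eqF// expR_gt0.
  by rewrite modg ger_pMr// -expR0 ler_expR.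
pose P x y := im (g (cplx x y)); pose Q x y := re (g (cplx x y)).
pose h : R := pi *+ 2.
have h0 : 0 < h by rewrite mulrn_wgt0// pi_gt0.
have [||||m0 /(_ m0 (leqnn _))] :=
  @goursat R P Q (- T) T 0 h (e * h / (2 * (T + h) ^+ 2)) => //.
- exact: ltW.
- have Th : 0 < T + h by lra.
  by rewrite divr_gt0 ?mulr_gt0.
- move=> x y xT _; apply: closed_form_has_deriv.
  by apply: differentiable_has_deriv; apply: dg; rewrite /re /=; lra.
have -> : e * h / (2 * (T + h) ^+ 2) * (T + h) ^+ 2 = e / 2 * h.
  by field; apply/eqP; lra.
rewrite /boundary_sum !add0r addNr.
have -> : P^~ h = P^~ 0.
  apply/funext => x; congr (im (F (_ * Complex _ _))); rewrite /re /im /=.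
    by rewrite /h cos2pi cos0.
  by rewrite /h sin2pi sin0.
rewrite subrr add0r ler_norml => /andP[+ _].
have Q0 : dyadic_sum m0 (Q 0) 0 h <= M * h.
  apply: dyadic_sum_le; first exact: ltW.
  by move=> y _; apply: FM; rewrite modg /re /= expR0 mulr1.
have QT : (re (F 0) - e / 2) * h <= dyadic_sum m0 (Q (- T)) 0 h.
  apply: dyadic_sum_ge; first exact: ltW.
  move=> y _; rewrite /Q /g.
  pose z := ofR r * cexp (cplx (- T) y).
  have /cF : modulus z <= d by rewrite modg.
  rewrite modulusC; have := re_le (F 0 - F z); rewrite reD reN -/z; lra.
move=> H; rewrite -(ler_pM2r h0); lra.
Qed.
End MaximumPrinciple.

(** * Cauchy estimates on a disc *)

Section Cauchy.
Variable R : realType.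
Local Notation C := (Cplx R).
Implicit Types (f H : C -> C) (z w l a b : C).

(** H(w) / w, with value l at 0, satisfies the hypotheses of the maximum principle at
the centre: it is differentiable off 0 and continuous at 0. *)
Lemma has_deriv_bound H r K l : 0 < r -> H 0 = 0 -> has_deriv H 0 l ->
  (forall w : C, modulus w <= r -> differentiable H w) ->
  (forall w : C, modulus w = r -> modulus (H w) <= K) -> modulus l <= K / r.
Proof.
move=> r0 H0 Hl dH HK; have [c c1 cl] := phase l.
pose G w := if w == 0 then c * l else c * (H w / w).
have GE w : w != 0 -> G w = c * (H w / w) by rewrite /G => /negbTE ->.
have G0 : G 0 = ofR (modulus l) by rewrite /G eqxx.
have -> : modulus l = re (G 0) by rewrite G0.
apply: (center_max_principle r0).
- move=> z z0 zr.
  have d : differentiable (fun w => c * (H w / w)) z.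
    apply: (@differentiableZ _ _ _ (fun w => H w / w) c).
    apply: (@differentiableM _ _ H (fun w => w^-1)); first exact: dH.
    exact: differentiable_Rinv.
  apply: near_eq_differentiable d.
  have : \forall w \near z, w != 0.
    exact: (@cvgr_neq0 C C _ (nbhs z) _ id z) cvg_id z0.
  by apply: filterS => w w0; rewrite GE.
- move=> e e0; have [d d0 Hd] := Hl e e0.
  exists d => // w wd; have [->|w0] := eqVneq w 0.
    by rewrite subrr modulus0 ltW.
  have := Hd w wd; rewrite H0 subr0 add0r GE// /G eqxx -mulrBr.
  have -> : H w / w - l = (H w - l * w) / w by rewrite mulrBl mulfK.
  by rewrite modulusM c1 mul1r modulusM modulusV ler_pdivrMr// modulus_gt0.
- move=> w wr; have w0 : w != 0.
    by apply/eqP => w0; move: wr; rewrite w0 modulus0 => /eqP; rewrite lt_eqF.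
  rewrite GE//; apply: le_trans (re_le _) _.
  rewrite modulusM c1 mul1r modulusM modulusV wr ler_wpM2r ?HK// invr_ge0 ltW//.
Qed.

(** The mean value inequality along the segment from a to b, from the real mean value
theorem for the real part of c f, where c is the phase of f(b) - f(a). *)
Lemma has_derivB_le f a b K :
  (forall t : R, 0 <= t <= 1 -> exists2 l, has_deriv f (a + ofR t * (b - a)) l &
     modulus l <= K) ->
  modulus (f b - f a) <= K * modulus (b - a).
Proof.
move=> df; have [c c1 cE] := phase (f b - f a).
pose phi (t : R) := re (c * f (a + ofR t * (b - a))).
have dphi (t : R) : 0 <= t <= 1 ->
    exists2 l, is_derive t 1 phi (re (c * (l * (b - a)))) & modulus l <= K.
  move=> /df[l fl lK]; exists l => //; apply/is_derive_expansion => e e0.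
  pose m := modulus (b - a); have m0 : 0 <= m by exact: modulus_ge0.
  have m1 : 0 < m + 1 by lra.
  have [|d d0 fd] := fl (e / (m + 1)); first by rewrite divr_gt0.
  exists (d / (m + 1)); first by rewrite divr_gt0.
  move=> h; rewrite ler_pdivlMr// => hd.
  have hm : modulus (ofR h * (b - a)) = `|h| * m by rewrite modulusM modulus_ofR.
  have := fd (ofR h * (b - a)); rewrite hm.
  have -> : a + ofR t * (b - a) + ofR h * (b - a) = a + ofR (t + h) * (b - a).
    by rewrite ofRD mulrDl addrA.
  set u := f _; set v := f _ => /(_ _) uv.
  have -> : phi (t + h) - phi t - re (c * (l * (b - a))) * h
      = re (c * (u - v - l * (ofR h * (b - a)))).
    rewrite /phi -/u -/v.
    have -> : re (c * (l * (b - a))) * h = re (c * (l * (ofR h * (b - a)))).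
      have -> : c * (l * (ofR h * (b - a))) = ofR h * (c * (l * (b - a))) by ring.
      by rewrite re_ofRM mulrC.
    by rewrite -!(reD, reN); congr re; ring.
  apply: le_trans (norm_re_le _) _; rewrite modulusM c1 mul1r.
  apply: le_trans (uv _) _.
    by apply: le_trans hd; rewrite ler_wpM2l//; lra.
  rewrite mulrAC -ler_pdivlMr ?invr_gt0// invrK.
  have : `|h| * m <= `|h| * (m + 1) by rewrite ler_wpM2l//; lra.
  by move=> /(ler_wpM2l (ltW e0)); lra.
have drv (t : R) : 0 <= t <= 1 -> derivable phi t 1.
  by move=> /dphi[l [] ? _ _].
have [||x x01] := @MVT R phi (fun t => 'D_1 phi t) 0 1 ltr01.
- move=> t; rewrite in_itv /= => /andP[t0 t1]; apply: derivableP; apply: drv.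
  by rewrite !ltW.
- apply: derivable_within_continuous => t; rewrite in_itv /= => t01.
  exact: drv.
have [] := dphi x; first by move: x01; rewrite in_itv /= => /andP[t0 t1]; rewrite !ltW.
move=> l [_ ->] lK.
have -> : modulus (f b - f a) = phi 1 - phi 0.
  rewrite /phi -[ofR 1]/(1 : C) -[ofR 0]/(0 : C) mul1r mul0r addr0.
  by rewrite [a + _]addrC subrK -reN -reD -mulrBr cE.
move=> ->; rewrite subr0 mulr1; apply: le_trans (re_le _) _.
by rewrite modulusM c1 mul1r modulusM ler_wpM2r ?modulus_ge0.
Qed.

Lemma has_deriv_shift f z w l : has_deriv f (z + w) l ->
  has_deriv (fun u => f (z + u)) w l.
Proof.
by move=> fl e /fl[d d0 fd]; exists d => // u /fd; rewrite addrA.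
Qed.

Lemma differentiable_shift f z w : differentiable f (z + w) ->
  differentiable (fun u => f (z + u)) w.
Proof.
by move=> /differentiable_has_deriv/has_deriv_shift/has_deriv_differentiable.
Qed.

Lemma has_derivB f g z l k : has_deriv f z l -> has_deriv g z k ->
  has_deriv (fun u => f u - g u) z (l - k).
Proof.
move=> fl gk e e0; have e2 : 0 < e / 2 by lra.
have [d d0 fd] := fl _ e2; have [d' d'0 gd] := gk _ e2.
exists (Num.min d d'); first by rewrite lt_min d0.
move=> w; rewrite le_min => /andP[/fd fw /gd gw].
set u := _ - l * _ in fw; set v := _ - k * _ in gw.
have -> : f (z + w) - g (z + w) - (f z - g z) - (l - k) * w = u - v.
  by rewrite /u /v; ring.
apply: le_trans (ler_modulusB _ _) _; lra.
Qed.

Lemma has_deriv_scale k z : has_deriv ( *%R k) z k.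
Proof.
move=> e e0; exists 1 => // w _.
have -> : k * (z + w) - k * z - k * w = 0 by ring.
by rewrite modulus0 mulr_ge0 ?modulus_ge0// ltW.
Qed.

Section Disc.
Variables (f : C -> C) (rho M : R).
Hypothesis rho0 : 0 < rho.
Hypothesis df : forall z : C, modulus z < rho -> differentiable f z.
Hypothesis fM : forall z : C, modulus z < rho -> modulus (f z) <= M.

Let add_lt (z w : C) (x y : R) :
  modulus z <= x -> modulus w <= y -> x + y < rho -> modulus (z + w) < rho.
Proof. by move=> zx wy; apply: le_lt_trans (le_trans (ler_modulusD _ _) (lerD _ _)). Qed.

Lemma cauchy_estimate z l : modulus z <= rho / 2 -> has_deriv f z l ->
  modulus l <= 8 * M / rho.
Proof.
have rp := rho0; move=> zr fl; have r4 : 0 < rho / 4 by lra.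
have -> : 8 * M / rho = 2 * M / (rho / 4) by field; rewrite gt_eqF.
have z_lt : modulus z < rho by lra.
pose H w := f (z + w) - f z.
apply: (has_deriv_bound (H := H) r4).
- by rewrite /H addr0 subrr.
- rewrite -[l]subr0; apply: has_derivB; first by apply: has_deriv_shift; rewrite addr0.
  move=> e e0; exists 1 => // w _.
  by rewrite subrr mul0r subr0 modulus0 mulr_ge0 ?modulus_ge0// ltW.
- move=> w wr; apply: differentiableB; last exact: differentiable_cst.
  by apply: differentiable_shift; apply: df; apply: (add_lt zr wr); lra.
- move=> w wr; apply: le_trans (ler_modulusB _ _) _.
  have zw_lt : modulus (z + w) < rho by apply: (add_lt zr (lexx _)); rewrite wr; lra.
  by have := fM z_lt; have := fM zw_lt; lra.
Qed.

Lemma disc_lipschitz a b : modulus a <= rho / 2 -> modulus b <= rho / 2 ->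
  modulus (f b - f a) <= 8 * M / rho * modulus (b - a).
Proof.
have rp := rho0; move=> ar br; apply: has_derivB_le => t /andP[t0 t1].
have tr : modulus (a + ofR t * (b - a)) <= rho / 2.
  have -> : a + ofR t * (b - a) = ofR (1 - t) * a + ofR t * b.
    by rewrite /ofR rmorphB rmorph1; ring.
  apply: le_trans (ler_modulusD _ _) _; rewrite !modulusM !modulus_ofR.
  rewrite !ger0_norm ?subr_ge0//.
  have : (1 - t) * modulus a <= (1 - t) * (rho / 2) by rewrite ler_wpM2l// subr_ge0.
  have : t * modulus b <= t * (rho / 2) by rewrite ler_wpM2l.
  lra.
have := @df (a + ofR t * (b - a)) ltac:(lra) => /differentiable_has_deriv fl.
by exists ('d f (a + ofR t * (b - a)) 1) => //; exact: cauchy_estimate fl.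
Qed.

(** The derivative at 0 of (f(a + w) - f(a)) - (f(w) - f(0)) is l - k, and the
Lipschitz bound for f makes this function small on a circle. *)
Lemma deriv_lipschitz a l k : modulus a <= rho / 4 ->
  has_deriv f a l -> has_deriv f 0 k ->
  modulus (l - k) <= 64 * M / rho ^+ 2 * modulus a.
Proof.
have rp := rho0; move=> ar fl fk; have r4 : 0 < rho / 4 by lra.
have -> : 64 * M / rho ^+ 2 * modulus a = 16 * M / rho * modulus a / (rho / 4).
  by field; rewrite gt_eqF.
pose H w := (f (a + w) - f (0 + w)) - (f a - f 0).
apply: (has_deriv_bound (H := H) r4).
- by rewrite /H !addr0 subrr.
- rewrite -[l - k]subr0; apply: has_derivB.
    by apply: has_derivB; apply: has_deriv_shift; rewrite ?addr0.
  move=> e e0; exists 1 => // w _.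
  by rewrite subrr mul0r subr0 modulus0 mulr_ge0 ?modulus_ge0// ltW.
- move=> w wr; apply: differentiableB; last exact: differentiable_cst.
  apply: differentiableB; apply: differentiable_shift; apply: df.
    by apply: (add_lt ar wr); lra.
  by rewrite add0r; lra.
- move=> w wr; rewrite /H add0r; apply: le_trans (ler_modulusB _ _) _.
  have h1 : modulus (f (a + w) - f w) <= 8 * M / rho * modulus (a + w - w).
    apply: disc_lipschitz; first by lra.
    by apply: le_trans (ler_modulusD _ _) _; lra.
  have h2 : modulus (f a - f 0) <= 8 * M / rho * modulus (a - 0).
    by apply: disc_lipschitz; rewrite ?modulus0; lra.
  by move: h1 h2; rewrite addrK subr0; lra.
Qed.

(** Mean value inequality for f(u) - k u, whose derivative is small by the Lipschitz
bound on f'. *)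
Lemma taylor_estimate t k : modulus t <= rho / 4 -> has_deriv f 0 k ->
  modulus (f t - f 0 - k * t) <= 64 * M / rho ^+ 2 * modulus t ^+ 2.
Proof.
have rp := rho0; move=> tr fk; pose g u := f u - k * u.
have -> : f t - f 0 - k * t = g t - g 0 by rewrite /g; ring.
rewrite [modulus t ^+ 2]expr2 mulrA -{3}[t]subr0; apply: has_derivB_le => s /andP[s0 s1].
rewrite add0r subr0.
have st : modulus (ofR s * t) <= modulus t.
  by rewrite modulusM modulus_ofR ger0_norm// ler_piMl ?modulus_ge0.
have := @df (ofR s * t) ltac:(lra) => /differentiable_has_deriv.
set l := 'd f _ _ => fl; exists (l - k).
  by apply: has_derivB => //; exact: has_deriv_scale.
apply: le_trans (deriv_lipschitz _ fl fk) _; first by lra.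
have M0 : 0 <= M.
  by apply: le_trans (modulus_ge0 (f 0)) _; apply: fM; rewrite modulus0.
by rewrite ler_wpM2l// divr_ge0 ?exprn_ge0//; lra.
Qed.

End Disc.
End Cauchy.

(** * Bounded holomorphic functions on the polydisc *)

Section PolydiscEstimates.
Variables (R : realType) (n : nat).
Local Notation C := (Cplx R).
Local Notation Cn := 'rV[C]_n.
Implicit Types (f : Cn -> C) (a b v : Cn) (M : R).

(** The norm of C^n takes values in C; this is the same number in R. *)
Definition vnorm v : R := modulus `|v|.

Lemma vnormE v : `|v| = ofR (vnorm v).
Proof. by rewrite /vnorm -norm_modulus normr_id. Qed.

Lemma near0_vnorm (P : Cn -> Prop) : (\forall h \near (0 : Cn), P h) <->
  exists2 d : R, 0 < d & forall h, vnorm h <= d -> P h.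
Proof.
split=> [/nbhs_ballP[e /= /posC[d d0 ->] dP]|[d d0 dP]].
  exists (d / 2); first by lra.
  move=> h hd; apply: dP; rewrite -ball_normE /ball_ /= sub0r normrN.
  rewrite vnormE ltcR; lra.
apply/nbhs_ballP; exists (ofR d); first by rewrite /= ltcR.
move=> h; rewrite -ball_normE /ball_ /= sub0r normrN vnormE ltcR => /ltW.
exact: dP.
Qed.

(** Restricting to complex lines reduces estimates in C^n to one variable. *)
Lemma has_deriv_slice f a v t : differentiable f (a + t *: v) ->
  has_deriv (fun s : C => f (a + s *: v)) t ('d f (a + t *: v) v).
Proof.
move=> df e e0; pose m := vnorm v.
have m0 : 0 <= m by exact: modulus_ge0.
have m1 : 0 < m + 1 by lra.
have e1 : 0 < e / (m + 1) by rewrite divr_gt0.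
have := diff_locally df => /eqaddoP/(_ (ofR (e / (m + 1)))).
rewrite ltcR => /(_ e1)/near0_vnorm[d d0 fd].
exists (d / (m + 1)); first by rewrite divr_gt0.
move=> w; rewrite ler_pdivlMr// => wd.
have wm : vnorm (w *: v) = modulus w * m.
  by rewrite /vnorm normrZ modulusM norm_modulus modulus_ofR ger0_norm ?modulus_ge0.
have /fd : vnorm (w *: v) <= d.
  by rewrite wm; apply: le_trans wd; rewrite ler_wpM2l ?modulus_ge0//; lra.
rewrite !fctE /= vnormE norm_modulus -ofRM ler_ofR wm.
have -> : 'd f (a + t *: v) (w *: v) = w * 'd f (a + t *: v) v by rewrite linearZ.
have -> : w *: v + (a + t *: v) = a + (t + w) *: v.
  by rewrite scalerDl addrC addrA.
rewrite opprD addrA [w * _]mulrC => H; apply: le_trans H _.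
have : modulus w * m <= modulus w * (m + 1) by rewrite ler_wpM2l ?modulus_ge0//; lra.
rewrite mulrAC ler_pdivrMr// => /(ler_wpM2l (ltW e0)); lra.
Qed.

Lemma coord_vnorm v j : modulus (v ord0 j) <= vnorm v.
Proof.
rewrite -ler_ofR -vnormE -norm_modulus.
suff : `|v ord0 j| <= mx_norm v by [].
rewrite mx_normE -[leLHS]nngE num_le.
exact: (le_bigmax _ (fun i : 'I_1 * 'I_n => `|v i.1 i.2|%:nng) (ord0, j)).
Qed.

Lemma polydisc_shift a v (t : C) (rho : R) : polydisc a -> modulus t < rho ->
  (forall j, rho * modulus (v ord0 j) <= 1 - modulus (a ord0 j)) ->
  polydisc (a + t *: v).
Proof.
move=> Ua tr av j; rewrite !mxE; apply: le_lt_trans (ler_modulusD _ _) _.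
rewrite modulusM; have := av j; have := Ua j.
have := modulus_ge0 (v ord0 j); rewrite le_eqVlt => /predU1P[<-|v0].
  by rewrite !mulr0; lra.
have : modulus t * modulus (v ord0 j) < rho * modulus (v ord0 j).
  by rewrite ltr_pM2r.
lra.
Qed.

Section Bounded.
Variables (f : Cn -> C) (M : R).
Hypothesis hf : holomorphic f.
Hypothesis fM : forall z, polydisc z -> modulus (f z) <= M.

(** The disc of radius 1/e in the complex line through a and b stays in the polydisc,
and b sits at the point 1 of it. *)
Lemma polydisc_lipschitz a b (e : R) : polydisc a -> 0 < e <= 2^-1 ->
  (forall j, modulus (b ord0 j - a ord0 j) <= e * (1 - modulus (a ord0 j))) ->
  polydisc b /\ modulus (f b - f a) <= 8 * M * e.
Proof.
move=> Ua /andP[e0 e2] ab.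
have rho2 : 2 <= e^-1 by rewrite -[2]invrK lef_pV2 ?posrE ?invr_gt0.
have inU (t : C) : modulus t < e^-1 -> polydisc (a + t *: (b - a)).
  move=> te; apply: (polydisc_shift Ua te) => j.
  by rewrite mulrC ler_pdivrMr// mulrC !mxE; exact: ab.
have bE : a + 1 *: (b - a) = b by rewrite scale1r addrC subrK.
split; first by rewrite -bE; apply: inU; rewrite modulus1; lra.
have rho0 : 0 < e^-1 by rewrite invr_gt0.
have := @disc_lipschitz R (fun t => f (a + t *: (b - a))) e^-1 M rho0 _ _ 0 1.
rewrite bE scale0r addr0 subr0 modulus1 modulus0 mulr1 invrK; apply.
- by move=> z /inU/hf/has_deriv_slice/has_deriv_differentiable.
- by move=> z /inU; exact: fM.
- by lra.
- by lra.
Qed.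

Lemma polydisc_derivative_le a v : polydisc a ->
  (forall j, modulus (v ord0 j) <= 1 - modulus (a ord0 j)) ->
  modulus ('d f a v) <= 8 * M.
Proof.
move=> Ua av.
have inU (t : C) : modulus t < 1 -> polydisc (a + t *: v).
  by move=> t1; apply: (polydisc_shift Ua t1) => j; rewrite mul1r.
have a0 : a + 0 *: v = a by rewrite scale0r addr0.
have fa : differentiable f (a + 0 *: v) by rewrite a0; exact: hf.
have := @cauchy_estimate R (fun t => f (a + t *: v)) 1 M ltr01 _ _ 0 ('d f a v).
rewrite divr1 modulus0; apply.
- by move=> z /inU/hf/has_deriv_slice/has_deriv_differentiable.
- by move=> z /inU; exact: fM.
- by lra.
- by have := has_deriv_slice fa; rewrite a0.
Qed.

(** One-variable Taylor estimate on the disc |t| < eta / s of the line a + t v, at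
t = 1; the constants do not depend on f. *)
Lemma polydisc_taylor a v (eta s : R) : polydisc a -> 0 < s -> s <= eta / 4 ->
  (forall j, eta <= 1 - modulus (a ord0 j)) -> (forall j, modulus (v ord0 j) <= s) ->
  modulus (f (a + v) - f a - 'd f a v) <= 64 * M / eta ^+ 2 * s ^+ 2.
Proof.
move=> Ua s0 se ea vs.
have eta0 : 0 < eta by lra.
have rho0 : 0 < eta / s by rewrite divr_gt0.
have rho4 : 4 <= eta / s by rewrite ler_pdivlMr//; lra.
have inU (t : C) : modulus t < eta / s -> polydisc (a + t *: v).
  move=> te; apply: (polydisc_shift Ua te) => j; apply: le_trans (ea j).
  by rewrite mulrAC ler_pdivrMr// ler_pM2l.
have a0 : a + 0 *: v = a by rewrite scale0r addr0.
have fa : differentiable f (a + 0 *: v) by rewrite a0; exact: hf.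
have := @taylor_estimate R (fun t => f (a + t *: v)) (eta / s) M rho0 _ _ 1 ('d f a v).
rewrite a0 scale1r mulr1 modulus1 expr1n mulr1.
have -> : 64 * M / (eta / s) ^+ 2 = 64 * M / eta ^+ 2 * s ^+ 2.
  by field; rewrite !gt_eqF.
apply.
- by move=> z /inU/hf/has_deriv_slice/has_deriv_differentiable.
- by move=> z /inU; exact: fM.
- by lra.
- by have := has_deriv_slice fa; rewrite a0.
Qed.

End Bounded.

End PolydiscEstimates.

(** * Limits along an ultrafilter and Montel's theorem *)

Section UltraLimit.
Variables (R : realType) (X : Type) (U : set_system X).
Hypothesis UF : UltraFilter U.
Local Notation C := (Cplx R).

Definition ultra_lim (h : X -> C) (l : C) :=
  forall e : R, 0 < e -> U [set x | modulus (h x - l) <= e].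

(** The limit is the supremum of the r such that r <= h on a set of U; that U decides
each set bounds h from above. *)
Lemma real_ultra_lim (h : X -> R) (B : R) : (forall x, `|h x| <= B) ->
  exists l : R, forall e : R, 0 < e -> U [set x | `|h x - l| <= e].
Proof.
move=> hB; pose S := [set r : R | U [set x | r <= h x]].
have SB : has_sup S.
  split.
    exists (- B); apply: filterS (filterT : U setT) => x _ /=.
    by have := hB x; rewrite ler_norml => /andP[].
  exists B => r Sr; have [x /= rx] := filter_ex Sr.
  by apply: le_trans rx _; have := hB x; rewrite ler_norml => /andP[].
exists (sup S) => e e0.
have [r Sr er] := sup_adherent e0 SB.
have [Se|Se] := in_ultra_setVsetC [set x | sup S + e <= h x] UF.
  have /(_ (sup S + e) Se) := sup_ubound SB.2; lra.
apply: filterS (filterI Sr Se) => x [/= rx /negP]; rewrite -ltNge => xe.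
by rewrite ler_norml; apply/andP; split; lra.
Qed.

Lemma ex_ultra_lim (h : X -> C) (B : R) : (forall x, modulus (h x) <= B) ->
  exists l, ultra_lim h l.
Proof.
move=> hB.
have [|a aP] := @real_ultra_lim (fun x => re (h x)) B.
  by move=> x; apply: le_trans (hB x); exact: norm_re_le.
have [|b bP] := @real_ultra_lim (fun x => im (h x)) B.
  by move=> x; apply: le_trans (hB x); exact: norm_im_le.
exists (cplx a b) => e e0; have e2 : 0 < e / 2 by lra.
apply: filterS (filterI (aP _ e2) (bP _ e2)) => x [/= xa xb].
apply: le_trans (modulus_le _) _; rewrite reD imD reN imN.
rewrite -[re (cplx a b)]/a -[im (cplx a b)]/b; lra.
Qed.
End UltraLimit.

Section QuadraticDifferentiable.
Variables (R : realType) (n : nat).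
Local Notation C := (Cplx R).
Local Notation Cn := 'rV[C]_n.

(** A pointwise limit of holomorphic functions inherits a quadratic remainder, and
this is what makes it differentiable. *)
Lemma quadratic_differentiable (f : Cn -> C) (a : Cn) (L : 'I_n -> C) (K d : R) :
  0 < d ->
  (forall (v : Cn) (s : R), 0 < s <= d -> (forall j, modulus (v ord0 j) <= s) ->
    modulus (f (a + v) - f a - \sum_j v ord0 j * L j) <= K * s ^+ 2) ->
  differentiable f a.
Proof.
move=> d0 fK.
pose ell (v : Cn) : C := \sum_j v ord0 j * L j.
have ellD u v : ell (u + v) = ell u + ell v.
  by rewrite -big_split; apply: eq_bigr => j _; rewrite mxE mulrDl.
have dell : differentiable ell a.
  have -> : ell = \sum_j (fun v : Cn => v ord0 j * L j).
    by apply/funext => v; rewrite fct_sumE.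
  apply: differentiable_sum => j.
  apply: (@differentiableM _ _ (fun v : Cn => v ord0 j) (cst (L j))).
    exact: differentiable_coord.
  exact: differentiable_cst.
pose g v := f v - ell v.
have gK (v : Cn) (s : R) : 0 < s <= d -> (forall j, modulus (v ord0 j) <= s) ->
    modulus (g (a + v) - g a) <= K * s ^+ 2.
  move=> sd vs; apply: le_trans (fK v s sd vs).
  suff -> : g (a + v) - g a = f (a + v) - f a - ell v by [].
  by rewrite /g ellD; ring.
have dg : differentiable g a.
  have dl : continuous ('d (cst (0 : C)) a : Cn -> C) by exact: diff_continuous.
  have eg : g \o shift a = cst (g a) + 'd (cst (0 : C)) a +o_ (0 : Cn) id.
    apply/eqaddoP => e /posC[r r0 ->]; apply/near0_vnorm.
    pose K1 := `|K| + 1; have K1_gt0 : 0 < K1 by rewrite ltr_wpDl.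
    exists (Num.min d (r / K1)); first by rewrite lt_min d0 divr_gt0.
    move=> v; rewrite le_min => /andP[vd vr].
    rewrite !fctE /= diff_cst vnormE norm_modulus -ofRM ler_ofR.
    rewrite -[(0 : Cn -> C) v]/(0 : C) addr0 [v + a]addrC.
    have : 0 <= vnorm v by exact: modulus_ge0.
    rewrite le_eqVlt => /predU1P[v0|v0].
      suff -> : v = 0 by rewrite addr0 subrr modulus0 mulr_ge0 ?modulus_ge0 ?ltW.
      by apply/normr0_eq0; rewrite vnormE -v0.
    have := gK v (vnorm v); rewrite v0 vd => /(_ isT (coord_vnorm v)) H.
    apply: le_trans H _; rewrite expr2 mulrA; apply: ler_wpM2r; first exact: ltW.
    apply: (@le_trans _ _ (K1 * vnorm v)).
      apply: ler_wpM2r; first exact: ltW.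
      by apply: le_trans (ler_norm _) _; rewrite lerDl.
    by rewrite mulrC -ler_pdivlMr.
  have E := diff_unique dl eg.
  by apply/diff_locallyP; rewrite E; split.
have -> : f = g + ell by apply/funext => v; rewrite fctE subrK.
exact: differentiableD.
Qed.
End QuadraticDifferentiable.

Section Montel.
Variables (R : realType) (n : nat) (X : Type) (U : set_system X).
Hypothesis UF : UltraFilter U.
Local Notation C := (Cplx R).
Local Notation Cn := 'rV[C]_n.

Lemma polydisc_margin (a : Cn) : polydisc a ->
  exists2 eta : R, 0 < eta <= 1 & forall j, eta <= 1 - modulus (a ord0 j).
Proof.
move=> Ua; exists (\big[Num.min/1]_j (1 - modulus (a ord0 j))).
  apply/andP; split; last exact: bigmin_le_id.
  by apply/bigmin_gtP; split => // j _; rewrite subr_gt0; exact: Ua.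
by move=> j; exact: bigmin_le_cond.
Qed.

Lemma diff_coord_sum (f : Cn -> C) a v :
  'd f a v = \sum_j v ord0 j * 'd f a (delta_mx ord0 j).
Proof.
rewrite {1}[v]row_sum_delta linear_sum; apply: eq_bigr => j _.
by rewrite linearZ.
Qed.

Variable s : X -> Hinf R n.
Hypothesis s1 : forall x z, polydisc z -> modulus (s x z) <= 1.

Lemma montel_pointwise : exists f : Cn -> C, forall z,
  (polydisc z -> ultra_lim U (fun x => s x z) (f z)) /\ (~ polydisc z -> f z = 0).
Proof.
have /choice[f fP] : forall z : Cn, exists w : C,
    (polydisc z -> ultra_lim U (fun x => s x z) w) /\ (~ polydisc z -> w = 0).
  move=> z; have [Uz|nUz] := pselect (polydisc z); last by exists 0.
  have [l lP] := ex_ultra_lim UF (fun x => s1 x Uz).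
  by exists l.
by exists f.
Qed.

(** Partial derivatives at a are bounded by the Cauchy estimate, hence have limits
L_j; the uniform Taylor estimate passes to the limit. *)
Lemma ultra_lim_differentiable (f : Cn -> C) (a : Cn) : polydisc a ->
  (forall z, polydisc z -> ultra_lim U (fun x => s x z) (f z)) ->
  differentiable f a.
Proof.
move=> Ua fP; have [eta /andP[eta0 eta1] etaP] := polydisc_margin Ua.
have sh x : holomorphic (s x) by have [] := HinfP (s x).
have /choice[L LP] : forall j, exists l,
    ultra_lim U (fun x => 'd (s x) a (delta_mx ord0 j)) l.
  move=> j; apply: (ex_ultra_lim UF (B := 8 / eta)) => x.
  have := polydisc_derivative_le (sh x) (s1 x) (a := a) (v := ofR eta *: delta_mx ord0 j).
  have -> : 'd (s x) a (ofR eta *: delta_mx ord0 j) =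
      ofR eta * 'd (s x) a (delta_mx ord0 j).
    by rewrite linearZ.
  rewrite modulusM modulus_ofR gtr0_norm// mulr1 ler_pdivlMr// mulrC; apply=> //.
  move=> k; rewrite !mxE modulusM modulus_ofR gtr0_norm// eqxx /=.
  by case: eqP => _; rewrite ?modulus1 ?modulus0 ?mulr1 ?mulr0 ?etaP// subr_ge0 ltW.
apply: (@quadratic_differentiable _ _ _ _ L (64 / eta ^+ 2) (eta / 4)).
  by lra.
move=> v t /andP[t0 teta] vt.
apply/ler_addgt0Pr => e e0.
(* The error made at a single x is at most c e': two values of s x and the
   n derivatives, each of which is weighted by a coordinate of v. *)
pose c : R := 2 + n%:R * t; have c0 : 0 < c by rewrite ltr_wpDr// mulr_ge0// ltW.
pose e' := e / c; have e'0 : 0 < e' by rewrite divr_gt0.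
have Uav : polydisc (a + v).
  move=> j; rewrite mxE; apply: le_lt_trans (ler_modulusD _ _) _.
  have := etaP j; have := vt j; lra.
have FL : U [set x | forall j, modulus ('d (s x) a (delta_mx ord0 j) - L j) <= e'].
  by apply: filter_forall => j; exact: LP.
have [x [[/= xav xa] xL]] :=
  filter_ex (filterI (filterI (fP _ Uav _ e'0) (fP _ Ua _ e'0)) FL).
have := polydisc_taylor (sh x) (s1 x) Ua t0 teta etaP vt.
rewrite mulr1 diff_coord_sum.
set S := \sum_j _ => H.
have -> : f (a + v) - f a - \sum_j v ord0 j * L j =
    (s x (a + v) - s x a - S) + ((s x a - f a) - (s x (a + v) - f (a + v)) +
    (S - \sum_j v ord0 j * L j)) by ring.
apply: le_trans (ler_modulusD _ _) _; apply: lerD => //.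
apply: le_trans (ler_modulusD _ _) _.
have -> : e = (e' + e') + n%:R * t * e'.
  by rewrite /e'; have : c != 0 by [rewrite gt_eqF]; rewrite /c => c'; field.
apply: lerD; first by apply: le_trans (ler_modulusB _ _) _; exact: lerD.
rewrite /S -sumrB.
have sumle (G : 'I_n -> C) (B : R) : (forall j, modulus (G j) <= B) ->
    modulus (\sum_j G j) <= n%:R * B.
  move=> GB; have -> : n%:R * B = \sum_(j < n) B.
    by rewrite sumr_const card_ord mulr_natl.
  by elim/big_ind2 : _ => //; [rewrite modulus0|move=> u x1 w x2 ux wx;
    apply: le_trans (ler_modulusD _ _) _; exact: lerD].
rewrite -mulrA; apply: sumle => j; rewrite -mulrBr modulusM.
by apply: ler_pM; rewrite ?modulus_ge0.
Qed.

Lemma montel : exists f : Hinf R n, (forall z, polydisc z -> modulus (f z) <= 1) /\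
  forall z, polydisc z -> ultra_lim U (fun x => s x z) (f z).
Proof.
have [f fP] := montel_pointwise.
have f1 z : polydisc z -> modulus (f z) <= 1.
  move=> Uz; apply/ler_addgt0Pr => e e0.
  have [x /= xe] := filter_ex ((fP z).1 Uz e e0).
  have -> : f z = s x z - (s x z - f z) by ring.
  by apply: le_trans (ler_modulusB _ _) _; rewrite lerD// s1.
have fin : f \in @Hinf_pred R n.
  apply/asboolP; split.
  - by move=> z Uz; apply: ultra_lim_differentiable => // w; exact: (fP w).1.
  - by exists 1.
  - by move=> z; exact: (fP z).2.
exists (MkHinf fin); split => // z Uz; exact: (fP z).1.
Qed.

End Montel.

Section Uniform.
Variables (R : realType) (n : nat) (X : Type) (U : set_system X).
Hypothesis UF : UltraFilter U.
Local Notation C := (Cplx R).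
Local Notation Cn := 'rV[C]_n.

Lemma interval_grid (N : nat) (x : R) : (0 < N)%N -> -1 <= x <= 1 ->
  exists k : 'I_(2 * N).+1, `|k%:R / N%:R - 1 - x| <= N%:R^-1.
Proof.
move=> N0 /andP[x0 x1]; have N0' : 0 < N%:R :> R by rewrite ltr0n.
have y0 : 0 <= N%:R * (x + 1) by rewrite mulr_ge0//; lra.
have /andP[ky yk] := truncn_itv y0.
have kN : (Num.truncn (N%:R * (x + 1)) < (2 * N).+1)%N.
  rewrite ltnS -(ler_nat R); apply: le_trans ky _.
  by rewrite natrM mulrC ler_wpM2r//; lra.
exists (Ordinal kN) => /=; move: ky yk; set k := Num.truncn _ => ky yk.
have -> : k%:R / N%:R - 1 - x = (k%:R - N%:R * (x + 1)) / N%:R.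
  by field; rewrite gt_eqF.
rewrite normrM normfV [`|N%:R|]ger0_norm// ler_piMl ?invr_ge0//.
by rewrite ler_norml; move: yk; rewrite -natr1 => yk; apply/andP; split; lra.
Qed.

Lemma polydisc_grid (d : R) : 0 < d -> exists (T : finType) (p : T -> Cn),
  forall z, polydisc z -> exists t, forall j, modulus (p t ord0 j - z ord0 j) <= d.
Proof.
move=> d0; pose N := (Num.bound (2 / d)).+1.
have N0 : (0 < N)%N by [].
have Nd : 2 / N%:R <= d.
  rewrite ler_pdivrMr ?ltr0n// mulrC -ler_pdivrMr//.
  apply: le_trans (ltW (archi_boundP _)) _; first by rewrite divr_ge0// ltW.
  by rewrite ler_nat.
pose T := {ffun 'I_n -> 'I_(2 * N).+1 * 'I_(2 * N).+1}.
pose p (t : T) : Cn := \row_j cplx ((t j).1%:R / N%:R - 1) ((t j).2%:R / N%:R - 1).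
exists T, p => z Uz.
have /choice[t tP] : forall j, exists kl : 'I_(2 * N).+1 * 'I_(2 * N).+1,
    `|kl.1%:R / N%:R - 1 - re (z ord0 j)| <= N%:R^-1 /\
    `|kl.2%:R / N%:R - 1 - im (z ord0 j)| <= N%:R^-1.
  move=> j; have zj := ltW (Uz j).
  have [|k kP] := @interval_grid N (re (z ord0 j)) N0.
    by rewrite -ler_norml; apply: le_trans (norm_re_le _) zj.
  have [|l lP] := @interval_grid N (im (z ord0 j)) N0.
    by rewrite -ler_norml; apply: le_trans (norm_im_le _) zj.
  by exists (k, l).
exists [ffun j => t j] => j; have [t1 t2] := tP j.
rewrite mxE ffunE; apply: le_trans (modulus_le _) _.
rewrite reD imD reN imN; apply: le_trans (lerD t1 t2) _.
by apply: le_trans Nd; rewrite mulr_natl mulr2n.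
Qed.

(** Equicontinuity reduces the claim to the points of a finite grid; the margin
1 - r is what the Lipschitz estimate needs. *)
Lemma ultra_lim_uniform (g : X -> Hinf R n) (M r e : R) :
  (forall x z, polydisc z -> modulus (g x z) <= M) ->
  (forall z, polydisc z -> ultra_lim U (fun x => g x z) 0) ->
  r < 1 -> 0 < e ->
  U [set x | forall z : Cn, polydisc z -> (forall j, modulus (z ord0 j) <= r) ->
     modulus (g x z) <= e].
Proof.
move=> gM g0 r1 e0; have [x0 _] := filter_ex (filterT : U setT).
have M0 : 0 <= M by apply: le_trans (modulus_ge0 _) (gM x0 0 (@polydisc0 _ _)).
have c0 : 0 < 16 * M + 16 by lra.
(* The mesh e1 (1 - r) lets a grid point be compared with z up to 8 M e1,
   which is at most e / 2. *)
pose e1 := Num.min 2^-1 (e / (16 * M + 16)).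
have e10 : 0 < e1 by rewrite lt_min invr_gt0 ltr0n divr_gt0.
have e12 : e1 <= 2^-1 by rewrite ge_min lexx.
have e1e : 8 * M * e1 <= e / 2.
  have : e1 <= e / (16 * M + 16) by rewrite ge_min lexx orbT.
  rewrite ler_pdivlMr// => ?; have : 0 <= e1 by exact: ltW.
  lra.
have [|T [p pP]] := @polydisc_grid (e1 * (1 - r)).
  by rewrite mulr_gt0// subr_gt0.
have e2 : 0 < e / 2 by lra.
have : U [set x | forall t : T, polydisc (p t) -> modulus (g x (p t)) <= e / 2].
  apply: filter_forall => t; have [Ut|nUt] := pselect (polydisc (p t)).
    by apply: filterS (g0 _ Ut _ e2) => x /=; rewrite subr0.
  by apply: filterS (filterT : U setT) => x _ /nUt.
apply: filterS => x /= gx z Uz zr.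
have [t tz] := pP z Uz.
have hx : holomorphic (g x) by have [] := HinfP (g x).
have [||Ut gt] := polydisc_lipschitz hx (gM x) (b := p t) (e := e1) Uz.
- by rewrite e10.
- move=> j; apply: le_trans (tz j) _; rewrite ler_wpM2l ?(ltW e10)//.
  by have := zr j; lra.
have -> : g x z = g x (p t) - (g x (p t) - g x z) by ring.
apply: le_trans (ler_modulusB _ _) _; have := gx t Ut; lra.
Qed.
End Uniform.

(** * The pseudo-hyperbolic distance and compactness *)

Section PseudoHyp.
Variable R : realType.
Local Notation C := (Cplx R).
Implicit Types a b : C.

Lemma modulus_conj a : modulus a^* = modulus a.
Proof. by have := norm_conjC a; rewrite !norm_modulus => /ofR_inj. Qed.

Lemma modulusX a m : modulus (a ^+ m) = modulus a ^+ m.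
Proof.
by elim: m => [|m IH]; rewrite ?expr0 ?modulus1// !exprS modulusM IH.
Qed.

Lemma sub_conjM_neq0 a b : modulus a < 1 -> modulus b < 1 -> 1 - a^* * b != 0.
Proof.
move=> a1 b1; apply/eqP => /subr0_eq /(congr1 modulus).
rewrite modulus1 modulusM modulus_conj => ab.
have : modulus a * modulus b < 1 * 1 by rewrite ltr_pM ?modulus_ge0.
by rewrite -ab mul1r ltxx.
Qed.

(** Equivalent to (1 - |a|^2)(1 - |b|^2) >= 0. *)
Lemma pseudo_hyp_le1 a b : modulus a < 1 -> modulus b < 1 -> pseudo_hyp a b <= 1.
Proof.
move=> a1 b1; rewrite /pseudo_hyp modulusM modulusV.
have nz := modulus_gt0 (sub_conjM_neq0 a1 b1).
rewrite ler_pdivrMr// mul1r !modulusE ler_wsqrtr//.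
have sq (z : C) : modulus z < 1 -> re z ^+ 2 + im z ^+ 2 <= 1.
  move=> z1; rewrite -[leLHS]sqr_sqrtr; last by rewrite addr_ge0 ?sqr_ge0.
  by rewrite -modulusE expr_le1 ?modulus_ge0// ltW.
have := sq _ a1; have := sq _ b1.
rewrite !(reD, imD, reN, imN, reM, imM).
have -> : re a^* = re a by case: (a).
have -> : im a^* = - im a by case: (a).
rewrite -[re 1]/(1 : R) -[im 1]/(0 : R).
set p := re a; set q := im a; set u := re b; set v := im b => h1 h2.
have : 0 <= (1 - (p ^+ 2 + q ^+ 2)) * (1 - (u ^+ 2 + v ^+ 2)).
  by rewrite mulr_ge0// subr_ge0.
lra.
Qed.

Lemma pseudo_hypC a b : pseudo_hyp a b = pseudo_hyp b a.
Proof.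
rewrite /pseudo_hyp !modulusM !modulusV modulusC; congr (_ / _).
by rewrite -[LHS]modulus_conj rmorphB rmorph1 rmorphM /= conjCK mulrC.
Qed.

(** Since |1 - conj(a) b| <= 2 (1 - |a|) + |b - a|, pseudo-hyperbolic closeness bounds
|b - a| relatively to the distance of a to the circle, as required by
[polydisc_lipschitz]. *)
Lemma pseudo_hyp_close a b (e : R) : modulus a < 1 -> modulus b < 1 ->
  e <= 5^-1 -> pseudo_hyp a b <= e ->
  modulus (b - a) <= 5 / 2 * e * (1 - modulus a).
Proof.
move=> a1 b1 e5; rewrite /pseudo_hyp modulusM modulusV.
have nz := modulus_gt0 (sub_conjM_neq0 a1 b1).
rewrite ler_pdivrMr// modulusC; set d := modulus (b - a) => ab.
have d0 : 0 <= d by exact: modulus_ge0.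
have e0 : 0 <= e by rewrite -(pmulr_lge0 _ nz); apply: le_trans ab.
have a0 := modulus_ge0 a.
have le : modulus (1 - a^* * b) <= 2 * (1 - modulus a) + d.
  have -> : 1 - a^* * b = (1 - a * a^*) - a^* * (b - a) by ring.
  apply: le_trans (ler_modulusB _ _) _; rewrite modulusM modulus_conj -/d.
  have -> : 1 - a * a^* = ofR (1 - modulus a ^+ 2).
    rewrite -normCK norm_modulus expr2 -ofRM /ofR rmorphB rmorph1 expr2.
    by [].
  rewrite modulus_ofR ger0_norm; last by rewrite subr_ge0 expr_le1// ltW.
  have : modulus a * d <= d by rewrite ler_piMl// ltW.
  have : modulus a ^+ 2 = modulus a * modulus a by rewrite expr2.
  have : 0 <= (1 - modulus a) * (1 - modulus a).
    by rewrite mulr_ge0// subr_ge0 ltW.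
  lra.
have {le} := ler_wpM2l e0 le.
have : e * d <= 5^-1 * d by rewrite ler_wpM2r.
have : 0 <= e * (1 - modulus a) by rewrite mulr_ge0// subr_ge0 ltW.
lra.
Qed.

End PseudoHyp.

Section Main.
Variables (R : realType) (n : nat) (phi psi : self_map R n).
Local Notation C := (Cplx R).
Local Notation Cn := 'rV[C]_n.
Local Notation T := (comp_op phi \- comp_op psi).

Definition maxhyp (z : Cn) : R :=
  \big[Num.max/0]_(j < n) pseudo_hyp (phi z ord0 j) (psi z ord0 j).

Lemma maxhyp_le1 z : polydisc z -> maxhyp z <= 1.
Proof.
move=> Uz; apply: bigmax_le => // j _; apply: pseudo_hyp_le1.
  exact: self_map_polydisc.
exact: self_map_polydisc.
Qed.

Lemma maxhyp_ge0 z : 0 <= maxhyp z.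
Proof. exact: bigmax_ge_id. Qed.

Lemma E_set_polydisc d z : E_set phi psi d z -> polydisc z.
Proof. by move=> [j _ []]. Qed.

Lemma diff_opE f z : polydisc z -> T f z = f (phi z) - f (psi z).
Proof.
move=> Uz; rewrite -[LHS]/(comp_op phi f z - comp_op psi f z).
by rewrite /= /comp_fun !patchE !ifT// inE.
Qed.

(** The sets E_delta decrease with delta, so the limit is a statement about a single
small delta. *)
Lemma cvg_sup_hyp :
  (sup [set maxhyp z | z in E_set phi psi delta] @[delta --> 0^'+] --> (0 : R)) <->
  forall e : R, 0 < e -> exists2 d : R, 0 < d &
    forall z, E_set phi psi d z -> maxhyp z <= e.
Proof.
split=> [/cvgrPdist_le cv e e0|H].
  have [d [d0 /= de]] := filter_ex (filterI (nbhs_right_gt (0 : R)) (cv e e0)).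
  exists d => // z Ez; apply: le_trans de; rewrite sub0r normrN.
  apply: le_trans (ler_norm _); apply: ub_le_sup; last by exists z.
  by exists 1 => _ [w /E_set_polydisc Uw <-]; exact: maxhyp_le1.
apply/cvgrPdist_le => e e0; have [d d0 dP] := H e e0.
near=> t; rewrite sub0r normrN.
have td : t <= d by near: t; exact: nbhs_right_le.
have [->|/set0P S0] := eqVneq (E_set phi psi t) set0.
  by rewrite image_set0 sup0 normr0 ltW.
have tP z : E_set phi psi t z -> maxhyp z <= e.
  move=> [j _ [Uz zt]]; apply: dP; exists j => //; split => //.
  by apply: le_lt_trans zt; lra.
have [z Ez] := S0; rewrite ger0_norm.
  by apply: ge_sup => [|_ [w Ew <-]]; [exists (maxhyp z), z|exact: tP].
apply: le_trans (maxhyp_ge0 z) _; apply: ub_le_sup; last by exists z.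
by exists e => _ [w Ew <-]; exact: tP.
Unshelve. all: by end_near. Qed.

Lemma Hinf_subE (f g : Hinf R n) z : (f - g) z = f z - g z.
Proof. by []. Qed.

Lemma Hinf_norm_le (f : Hinf R n) (r : R) : (`|f| <= ofR r) = (supnorm f <= r).
Proof. exact: lecR. Qed.

(** On E_delta the images of z are close to each other; off E_delta both lie in the
polydisc of radius 1 - delta, where g converges uniformly. *)
Lemma ultra_lim_T (X : Type) (U : set_system X) (UF : UltraFilter U)
    (g : X -> Hinf R n) (e : R) :
  (forall e : R, 0 < e -> exists2 d : R, 0 < d &
    forall z, E_set phi psi d z -> maxhyp z <= e) ->
  (forall x z, polydisc z -> modulus (g x z) <= 2) ->
  (forall z, polydisc z -> ultra_lim U (fun x => g x z) 0) -> 0 < e ->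
  U [set x | supnorm (T (g x)) <= e].
Proof.
move=> H g2 g0 e0.
(* A pseudo-hyperbolic distance e1 gives a variation of g of at most
   8 * 2 * (5 / 2 * e1) = 40 e1. *)
pose e1 := Num.min 5^-1 (e / 40).
have e10 : 0 < e1 by rewrite lt_min invr_gt0 ltr0n divr_gt0.
have e15 : e1 <= 5^-1 by rewrite ge_min lexx.
have e1e : e1 <= e / 40 by rewrite ge_min lexx orbT.
have [d d0 dP] := H e1 e10.
have e2 : 0 < e / 2 by lra.
have d1 : 1 - d < 1 by lra.
apply: filterS (ultra_lim_uniform UF g2 g0 d1 e2) => x /= gx.
apply: supnorm_le => z Uz; rewrite diff_opE//.
have Up := self_map_polydisc phi Uz; have Us := self_map_polydisc psi Uz.
have [Ez|nEz] := pselect (E_set phi psi d z).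
  have hx : holomorphic (g x) by have [] := HinfP (g x).
  have [||_ +] := polydisc_lipschitz hx (g2 x) (a := phi z) (b := psi z)
    (e := 5 / 2 * e1) Up.
  - by apply/andP; split; lra.
  - move=> j; apply: pseudo_hyp_close => //.
    by apply: le_trans (dP z Ez); exact: le_bigmax.
  - by rewrite modulusC; lra.
have small j : Num.max (modulus (phi z ord0 j)) (modulus (psi z ord0 j)) <= 1 - d.
  by rewrite leNgt; apply/negP => lt; apply: nEz; exists j.
apply: le_trans (ler_modulusB _ _) _.
have h1 : modulus (g x (phi z)) <= e / 2.
  by apply: gx => // j; have := small j; rewrite ge_max => /andP[].
have h2 : modulus (g x (psi z)) <= e / 2.
  by apply: gx => // j; have := small j; rewrite ge_max => /andP[].
lra.
Qed.

(** The image of the unit ball is itself compact: an ultrafilter on it is lifted to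
the unit ball by a choice of preimages s, and Montel's theorem provides the
limit. *)
Lemma compact_of_small_hyp :
  (forall e : R, 0 < e -> exists2 d : R, 0 < d &
    forall z, E_set phi psi d z -> maxhyp z <= e) ->
  compact_operator T.
Proof.
move=> H; rewrite /compact_operator; set B := [set x | _].
have BE (f : Hinf R n) : B f <-> forall z, polydisc z -> modulus (f z) <= 1.
  rewrite /B /= -[1]/(ofR (1 : R)) Hinf_norm_le; split=> [f1 z Uz|f1].
    by apply: le_trans f1; exact: le_supnorm.
  exact: supnorm_le.
suff cTB : compact (T @` B).
  have /closure_id <- // : closed (T @` B).
  by apply: compact_closed => //; exact: norm_hausdorff.
rewrite compact_ultra => F FF FTB.
have /choice[s sP] : forall g, exists f, B f /\ ((T @` B) g -> T f = g).
  move=> g; have [[f Bf <-]|ng] := pselect ((T @` B) g); first by exists f.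
  exists 0; split => //; apply/BE => z Uz.
  by rewrite -[X in modulus X]/(0 : C) modulus0.
have s1 g z : polydisc z -> modulus (s g z) <= 1.
  by move=> Uz; have [/BE sg1 _] := sP g; exact: sg1.
have [f [f1 fP]] := montel FF s1.
exists (T f); split; first by exists f => //; apply/BE.
move=> A /nbhs_ballP[e /= /posC[r r0 ->]] rA.
have r2 : 0 < r / 2 by lra.
pose h g := f - s g.
have hE g z : h g z = f z - s g z by rewrite Hinf_subE.
have h2 g z : polydisc z -> modulus (h g z) <= 2.
  move=> Uz; rewrite hE; apply: le_trans (ler_modulusB _ _) _.
  by have := f1 z Uz; have := s1 g z Uz; lra.
have h0 z : polydisc z -> ultra_lim F (fun g => h g z) 0.
  move=> Uz t t0; apply: filterS (fP z Uz t t0) => g sg.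
  by rewrite /mkset subr0 hE modulusC.
apply: filterS (filterI FTB (ultra_lim_T FF H h2 h0 r2)) => g [/(sP g).2 sg gr].
apply: rA; rewrite -ball_normE /ball_ /=.
have <- : T (h g) = T f - g by rewrite -[in RHS]sg; exact: raddfB.
apply: (@le_lt_trans _ _ (ofR (r / 2))).
  by rewrite Hinf_norm_le.
by rewrite ltcR; lra.
Qed.

Lemma peak_function (m : nat) (i j : 'I_n) (b : C) : modulus b < 1 ->
  exists f : Hinf R n, forall w, polydisc w ->
    f w = w ord0 i ^+ m * ((w ord0 j - b) / (1 - b^* * w ord0 j)) /\
    modulus (f w) <= modulus (w ord0 i) ^+ m.
Proof.
move=> b1; pose f (w : Cn) : C := w ord0 i ^+ m * ((w ord0 j - b) / (1 - b^* * w ord0 j)).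
have fm w : polydisc w -> modulus (f w) <= modulus (w ord0 i) ^+ m.
  move=> Uw; rewrite modulusM modulusX ler_piMr ?exprn_ge0 ?modulus_ge0//.
  rewrite modulusM modulusC -modulusM; exact: pseudo_hyp_le1.
have df w : polydisc w -> differentiable f w.
  move=> Uw; have nz := sub_conjM_neq0 b1 (Uw j).
  have di : differentiable (fun w : Cn => w ord0 i) w by exact: differentiable_coord.
  have dj : differentiable (fun w : Cn => w ord0 j) w by exact: differentiable_coord.
  have dX : differentiable (fun w : Cn => w ord0 i ^+ m) w.
    have -> : (fun w : Cn => w ord0 i ^+ m) = (fun w : Cn => w ord0 i) ^+ m.
      by apply/funext => u; rewrite fctE.
    case: (m) => [|m']; last exact: differentiableX.
    by rewrite expr0; exact: differentiable_cst.
  have dB : differentiable (fun w : Cn => w ord0 j - b) w.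
    exact: (@differentiableB C Cn C (fun w : Cn => w ord0 j) (cst b) w dj
      (differentiable_cst _ _)).
  have dZ : differentiable (fun w : Cn => b^* * w ord0 j) w.
    exact: (@differentiableZ C Cn C (fun w : Cn => w ord0 j) b^* w dj).
  have dD : differentiable (fun w : Cn => 1 - b^* * w ord0 j) w.
    exact: (@differentiableB C Cn C (cst (1 : C)) (fun w : Cn => b^* * w ord0 j) w
      (differentiable_cst _ _) dZ).
  have dV : differentiable (fun w : Cn => (1 - b^* * w ord0 j)^-1) w.
    exact: (@differentiableV C Cn (fun w : Cn => 1 - b^* * w ord0 j) w dD nz).
  have dMV := @differentiableM C Cn (fun w : Cn => w ord0 j - b)
    (fun w : Cn => (1 - b^* * w ord0 j)^-1) w dB dV.
  exact: (@differentiableM C Cn (fun w : Cn => w ord0 i ^+ m)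
    (fun w : Cn => (w ord0 j - b) / (1 - b^* * w ord0 j)) w dX dMV).
have fE w : polydisc w -> patch (fun=> 0) polydisc f w = f w.
  by move=> Uw; rewrite patchE ifT// inE.
have fin : patch (fun=> 0) polydisc f \in @Hinf_pred R n.
  apply/asboolP; split=> [z Uz||z nUz].
  - apply: near_eq_differentiable (df z Uz).
    apply: filterS (open_nbhs_nbhs (conj (@open_polydisc R n) Uz)) => w Uw.
    exact/esym/fE.
  - exists 1 => z Uz; rewrite fE//; apply: le_trans (fm z Uz) _.
    by rewrite exprn_ile1 ?modulus_ge0// ltW// Uz.
  - by rewrite patchE ifN// notin_setE.
exists (MkHinf fin) => w Uw /=.
by rewrite fE//; split => //; exact: fm.
Qed.

(** The Blaschke factor vanishes at the image whose i-th coordinate is not known to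
be large, so that only the other image contributes. *)
Lemma peak_difference (d : R) (m : nat) (j : 'I_n) z : d <= 1 -> E_set phi psi d z ->
  exists2 i : 'I_n, True & exists2 f : Hinf R n,
    forall w, polydisc w -> modulus (f w) <= modulus (w ord0 i) ^+ m &
    (1 - d) ^+ m * pseudo_hyp (phi z ord0 j) (psi z ord0 j) <= modulus (T f z).
Proof.
move=> d1 [i _ [Uz]].
have Up := self_map_polydisc phi Uz; have Us := self_map_polydisc psi Uz.
rewrite lt_max => /orP[iz|iz]; exists i => //.
- have [f fP] := peak_function m i j (Us j); exists f => [w /fP[]//|].
  rewrite diff_opE// (fP _ Up).1 (fP _ Us).1 subrr mul0r mulr0 subr0.
  rewrite modulusM modulusX pseudo_hypC /pseudo_hyp !modulusM.
  rewrite [modulus (_ - phi z ord0 j)]modulusC.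
  rewrite ler_wpM2r ?mulr_ge0 ?modulus_ge0//.
  by rewrite lerXn2r ?nnegrE ?modulus_ge0 ?subr_ge0// ltW.
- have [f fP] := peak_function m i j (Up j); exists f => [w /fP[]//|].
  rewrite diff_opE// (fP _ Up).1 (fP _ Us).1 subrr mul0r mulr0 sub0r modulusN.
  rewrite modulusM modulusX /pseudo_hyp !modulusM.
  rewrite [modulus (_ - psi z ord0 j)]modulusC.
  rewrite ler_wpM2r ?mulr_ge0 ?modulus_ge0//.
  by rewrite lerXn2r ?nnegrE ?modulus_ge0 ?subr_ge0// ltW.
Qed.

Lemma bernoulli (d : R) m : 0 <= d <= 1 -> 1 - m%:R * d <= (1 - d) ^+ m.
Proof.
move=> /andP[d0 d1]; elim: m => [|m IH]; first by rewrite mul0r subr0 expr0.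
rewrite exprS; apply: (@le_trans _ _ ((1 - d) * (1 - m%:R * d))); last first.
  by rewrite ler_wpM2l ?subr_ge0.
rewrite -natr1; have : 0 <= m%:R * (d * d) by rewrite !mulr_ge0.
lra.
Qed.

(** A limit point p of the images T f_m in norm would vanish, as T f_m tends to 0
pointwise, whereas all T f_m have norm at least e / 2. *)
Lemma small_hyp_of_compact : compact_operator T ->
  forall e : R, 0 < e -> exists2 d : R, 0 < d &
    forall z, E_set phi psi d z -> maxhyp z <= e.
Proof.
move=> cT e e0; apply: contrapT => nd.
(* Bernoulli's inequality gives (1 - d m)^m >= 1/2 for this choice. *)
pose d (m : nat) : R := (2 * m.+1%:R)^-1.
have dm m : 0 < d m by rewrite invr_gt0 mulr_gt0.
have /choice[f fP] : forall m, exists f : Hinf R n,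
    (forall w, polydisc w -> exists i : 'I_n, modulus (f w) <= modulus (w ord0 i) ^+ m) /\
    e / 2 <= supnorm (T f).
  move=> m; have [z Ez ze] : exists2 z, E_set phi psi (d m) z & e < maxhyp z.
    apply: contrapT => nz; apply: nd; exists (d m) => // z Ez.
    by rewrite leNgt; apply/negP => lt; apply: nz; exists z.
  have [j _ je] : exists2 j : 'I_n, true & e <= pseudo_hyp (phi z ord0 j) (psi z ord0 j).
    by move: (ltW ze) => /bigmax_geP[|//]; lra.
  have d1 : d m <= 2^-1.
    by rewrite lef_pV2 ?posrE ?mulr_gt0// ler_pMr// ler1n.
  have dm1 : d m <= 1 by lra.
  have [i _ [f fi Tf]] := peak_difference m j dm1 Ez.
  exists f; split => [w Uw|]; first by exists i; exact: fi.
  apply: le_trans (le_supnorm _ (E_set_polydisc Ez)); apply: le_trans Tf.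
  have half : 2^-1 <= (1 - d m) ^+ m.
    apply: le_trans (bernoulli m _); last by rewrite (ltW (dm m)).
    have : m%:R * d m <= 2^-1.
      rewrite /d ler_pdivrMr ?mulr_gt0// mulrA mulVf// mul1r ler_nat//.
    lra.
  by rewrite mulrC; apply: ler_pM => //; rewrite ltW.
pose F : set_system (Hinf R n) := (fun m => T (f m)) @ \oo.
have fz z : polydisc z -> forall t : R, 0 < t ->
    \forall m \near \oo, modulus (f m z) <= t.
  move=> Uz t t0; have [eta /andP[eta0 eta1] etaP] := polydisc_margin Uz.
  have cv : (1 - eta) ^+ m @[m --> \oo] --> (0 : R).
    by apply: cvg_expr; rewrite ger0_norm; lra.
  move/cvgrPdist_le : cv => /(_ t t0); apply: filterS => m.
  rewrite sub0r normrN; apply: le_trans; apply: le_trans (ler_norm _).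
  have [i fi] := (fP m).1 z Uz; apply: le_trans fi _.
  by rewrite lerXn2r ?nnegrE ?modulus_ge0//;
    have := etaP i; have := modulus_ge0 (z ord0 i); lra.
have FT : F (closure (T @` [set x | `|x| <= 1])).
  exists 0%N => // m _ /=; apply: subset_closure; exists (f m) => //.
  rewrite /= -[1]/(ofR (1 : R)) Hinf_norm_le; apply: supnorm_le => w Uw.
  have [i fi] := (fP m).1 w Uw; apply: le_trans fi _.
  by rewrite exprn_ile1 ?modulus_ge0// ltW// Uw.
have [p [_ pF]] := cT F _ FT.
have near_p (A : set (Hinf R n)) (t : R) : F A -> 0 < t ->
    exists2 g, A g & supnorm (p - g) < t.
  move=> FA t0; have [|g [Ag]] := pF A (ball p (ofR t)) FA.
    by apply: nbhsx_ballx; rewrite ltcR.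
  by rewrite -ball_normE /ball_ /= ltcR; exists g.
have p0 z : polydisc z -> modulus (p z) <= 0.
  move=> Uz; apply/ler_addgt0Pr => t t0; rewrite add0r.
  have t3 : 0 < t / 3 by lra.
  have [|g gz gp] := near_p [set g | modulus (g z) <= t / 3 * 2] (t / 3) _ t3.
    have [N1 _ h1] := fz _ (self_map_polydisc phi Uz) _ t3.
    have [N2 _ h2] := fz _ (self_map_polydisc psi Uz) _ t3.
    exists (maxn N1 N2) => // m mN.
    have {}h1 := h1 m (leq_trans (leq_maxl N1 N2) mN).
    have {}h2 := h2 m (leq_trans (leq_maxr N1 N2) mN).
    rewrite /= in h1 h2; suff : modulus (T (f m) z) <= t / 3 * 2 by [].
    by rewrite diff_opE//; apply: le_trans (ler_modulusB _ _) _; lra.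
  have -> : p z = (p - g) z + g z by rewrite Hinf_subE subrK.
  apply: le_trans (ler_modulusD _ _) _.
  have := le_supnorm (p - g) Uz; rewrite /= in gz *; lra.
have e2 : 0 < e / 2 by lra.
have [|g [m _ <-] gp] := near_p (range (fun m => T (f m))) (e / 2) _ e2.
  by exists 0%N => // m _; exists m.
have := (fP m).2; rewrite leNgt => /negP; apply.
apply: le_lt_trans gp; apply: supnorm_le => z Uz.
have -> : T (f m) z = p z - (p - T (f m)) z.
  by rewrite (Hinf_subE p) opprB addrC subrK.
apply: le_trans (ler_modulusB _ _) _.
have := p0 z Uz; have := le_supnorm (p - T (f m)) Uz; lra.
Qed.

End Main.

Unset Implicit Arguments.

Theorem mainTheorem2 (R : realType) (n : nat) (n_gt0 : (0 < n)%N)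
    (phi psi : self_map R n) :
  compact_operator (comp_op phi \- comp_op psi) <->
  sup [set \big[Num.max/0]_(j < n) pseudo_hyp (phi z ord0 j) (psi z ord0 j)
      | z in E_set phi psi delta] @[delta --> 0^'+] --> (0 : R).
Proof.
by split=> [/small_hyp_of_compact/cvg_sup_hyp|/cvg_sup_hyp/compact_of_small_hyp].
Qed.
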